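(* Let $L=\mathrm{Lie}(G)$ be the Lie algebra of a compact semisimple Lie group $G$, equipped with the inner product given by the negative of its Killing form. Then $L$ has orthogonal Cartan subalgebras, where one of them can be chosen arbitrarily: for every Cartan subalgebra $C$ of $L$ there exists a Cartan subalgebra $C'$ of $L$ such that $C$ and $C'$ are orthogonal.
   Context: In the Lie algebra $L$ of a compact semisimple Lie group, Cartan subalgebras are the same as maximal toral (equivalently, maximal abelian) subalgebras. Two subspaces are orthogonal if every element of one is orthogonal to every element of the other. *)

(* Defs.v *)
From HB Require Import structures.
From mathcomp Require Import all_boot all_order all_algebra.
From mathcomp Require Import all_classical all_reals all_analysis.

Set Implicit Arguments.
Unset Strict Implicit.
Unset Printing Implicit Defensive.

Import Order.TTheory GRing.Theory Num.Theory.
Import numFieldNormedType.Exports.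

Local Open Scope classical_set_scope.
Local Open Scope ring_scope.

(* Smooth maps between normed modules.  The set [U] is meant to be open, so  *)
(* that values of [f] outside [U] are irrelevant.                            *)

Fixpoint iter_derive (R : realType) (V W : normedModType R) (vs : seq V)
    (f : V -> W) : V -> W :=
  if vs is v :: vs' then 'D_v (iter_derive vs' f) else f.

Definition smooth_on (R : realType) (V W : normedModType R) (U : set V)
    (f : V -> W) : Prop :=
  forall (vs : seq V) (x : V), U x -> differentiable (iter_derive vs f) x.

(* A chart is total as a function; only its restriction to [chart_dom], and   *)
(* that of [chart_inv] to [chart_im], is meaningful.                         *)

Record chart (R : realType) (n : nat) (T : topologicalType) := Chart {
  chart_dom : set T;
  chart_map :> T -> 'rV[R]_n;
  chart_inv : 'rV[R]_n -> T;
  chart_dom_open : open chart_dom;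
  chart_im_open : open (chart_map @` chart_dom);
  chartK : forall x, chart_dom x -> chart_inv (chart_map x) = x;
  chart_continuous : {within chart_dom, continuous chart_map};
  chart_inv_continuous :
    {within chart_map @` chart_dom, continuous chart_inv}
}.

Definition chart_im (R : realType) (n : nat) (T : topologicalType)
  (c : chart R n T) : set 'rV[R]_n := c @` chart_dom c.

#[short(type="topGroupType")]
HB.structure Definition TopGroup := {G of Topological G & Group G}.

Local Open Scope group_scope.

(* An [n]-dimensional real Lie group: [lie_mul_smooth] expresses smoothness   *)
(* of the multiplication with respect to the product charts of [G * G].      *)

Record lieGroup (R : realType) (n : nat) := LieGroup {
  lie_sort :> topGroupType;
  lie_hausdorff : hausdorff_space lie_sort;
  lie_second_countable : @second_countable lie_sort;
  lie_atlas : set (chart R n lie_sort);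
  lie_cover : forall g : lie_sort, exists2 c, lie_atlas c & chart_dom c g;
  lie_compat : forall c c', lie_atlas c -> lie_atlas c' ->
    smooth_on (c @` (chart_dom c `&` chart_dom c'))
              (fun x => c' (chart_inv c x));
  lie_mul_continuous : continuous (fun z : lie_sort * lie_sort => z.1 * z.2);
  lie_inv_continuous : continuous (fun g : lie_sort => g^-1);
  lie_mul_smooth : forall c1 c2 c3,
    lie_atlas c1 -> lie_atlas c2 -> lie_atlas c3 ->
    smooth_on [set z : 'rV[R]_n * 'rV[R]_n |
                 [/\ chart_im c1 z.1, chart_im c2 z.2 &
                     chart_dom c3 (chart_inv c1 z.1 * chart_inv c2 z.2)]]
              (fun z => c3 (chart_inv c1 z.1 * chart_inv c2 z.2));
  lie_inv_smooth : forall c c', lie_atlas c -> lie_atlas c' ->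
    smooth_on [set x | chart_im c x /\ chart_dom c' (chart_inv c x)^-1]
              (fun x => c' (chart_inv c x)^-1)
}.

(* Lie(G) in a chart [c] around the identity: the tangent space at 1 is       *)
(* identified with 'rV_n by the differential of [c] at 1.  The coordinate     *)
(* expression of the left-invariant vector field with value [u] at 1 is       *)
(* x |-> d(c \o L_g \o c^-1)_(c 1) u, where g = c^-1 x, and the bracket of    *)
(* [u] and [v] is the value at 1 of the commutator of their fields.          *)

Definition left_invariant_field (R : realType) (n : nat) (G : lieGroup R n)
    (c : chart R n G) (u x : 'rV[R]_n) : 'rV[R]_n :=
  'D_u (fun y => c (chart_inv c x * chart_inv c y)) (c 1).

Local Close Scope group_scope.

Definition field_bracket (R : realType) (V : normedModType R)
    (X Y : V -> V) (x : V) : V :=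
  'D_(X x) Y x - 'D_(Y x) X x.

Definition lie_bracket (R : realType) (n : nat) (G : lieGroup R n)
    (c : chart R n G) (u v : 'rV[R]_n) : 'rV[R]_n :=
  field_bracket (left_invariant_field c u) (left_invariant_field c v)
    (c 1%g).

(* Lie algebra notions, for a (bilinear) bracket on 'rV_n.                   *)

Section LieAlgebra.
Variables (R : realType) (n : nat) (br : 'rV[R]_n -> 'rV[R]_n -> 'rV[R]_n).
Local Notation L := 'rV[R]_n.
Implicit Types (x y : L) (U V I H C : {vspace L}).

(* As [br] is bilinear, this is the span of all the [br u v] with u in U and  *)
(* v in V.                                                                   *)
Definition bracketv U V : {vspace L} :=
  <<[seq br u v | u <- vbasis U, v <- vbasis V]>>%VS.

Definition is_subalgebra H : Prop :=
  forall x y, x \in H -> y \in H -> br x y \in H.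

Definition is_ideal I : Prop := forall x y, y \in I -> br x y \in I.

Definition is_nilpotent H : Prop :=
  exists k, iter k (bracketv H) H = 0%VS.

Definition is_solvable H : Prop :=
  exists k, iter k (fun U => bracketv U U) H = 0%VS.

Definition is_semisimple : Prop :=
  forall I, is_ideal I -> is_solvable I -> I = 0%VS.

Definition is_cartan C : Prop :=
  [/\ is_subalgebra C, is_nilpotent C &
      forall x, (forall y, y \in C -> br x y \in C) -> x \in C].

Definition ad x : 'M[R]_n := lin1_mx (br x).

Definition killing x y : R := \tr (ad x *m ad y).

Definition killing_dot x y : R := - killing x y.

Definition killing_orthogonal U V : Prop :=
  forall x y, x \in U -> y \in V -> killing_dot x y = 0.

End LieAlgebra.

(* Main.v *)
(* Compactness of G makes Ad(G) a bounded group of matrices, so that L has an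
   Ad(G)-invariant inner product and its Killing form is negative definite.  For a
   Cartan subalgebra C, the reflections in a basis of roots lift to automorphisms of
   L that are products of automorphisms close to the identity; their product phi
   preserves C and has no nonzero fixed vector there, like a Coxeter element.  Among
   the factorisations of phi into a given large number of automorphisms, consider one
   of minimal energy: its first variation forces all factors to be equal.  So phi is
   a high power of an automorphism close to 1 and, in the limit, phi = exp (ad y).
   A maximal abelian C' containing y is fixed pointwise by phi, and is therefore
   orthogonal to (phi - 1) C = C. *)
Require Import Defs.
From mathcomp Require Import all_boot all_order all_algebra.
From mathcomp Require Import all_classical all_reals all_analysis.
From mathcomp Require Import ring lra zify.

Set Implicit Arguments.
Unset Strict Implicit.
Unset Printing Implicit Defensive.

Import Order.TTheory GRing.Theory Num.Theory.
Import numFieldNormedType.Exports.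

Local Open Scope classical_set_scope.
Local Open Scope ring_scope.

(** * Limits along an ultrafilter *)

(** The usual way to write phi as an exponential uses geodesic completeness or maximal tori, and the
    usual roots need complexification; both are avoided. Automorphisms are real matrices, orthogonal
    for the negative Killing form, so that factorisations of a given length form a compact set and
    an energy minimiser exists. The notion [reach] records just what makes its energy small: for
    each i, a factorisation of length m 2^i whose factors are within C / 2^i of 1, hence of energy
    O(2^-i). It is stable under products, whereas a product of exponentials is not visibly an
    exponential. No exponential series occurs: one-parameter groups are limits of 2^k-th powers of
    automorphisms whose difference quotients at scale 2^-k tend to ad z. As G is given by charts
    only, such automorphisms are obtained as Ad of points near 1. The Jacobi identity is not assumed
    either; it comes from differentiating their compatibility with the bracket. Semisimplicity
    serves to make ad injective. *)

Definition ultra_nat : set_system nat :=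
  projT1 (cid (ultraFilterLemma eventually_filter)).

Instance ultra_nat_ultra : UltraFilter ultra_nat.
Proof. by rewrite /ultra_nat; case: cid => G []. Qed.

Lemma eventually_ultra : \oo `<=` ultra_nat.
Proof. by rewrite /ultra_nat; case: cid => G []. Qed.

Lemma cvg_ultra (T : topologicalType) (u : nat -> T) (l : T) :
  u @ \oo --> l -> u @ ultra_nat --> l.
Proof. by move=> ul A /ul; exact: eventually_ultra. Qed.

(** Compactness gives a cluster point, and an ultrafilter converges to each of its cluster points,
    since it contains every set or its complement. *)
Lemma ultra_bounded_cvg (R : realType) (u : nat -> R) (M : R) :
  (forall k, `|u k| <= M) -> exists l : R, u @ ultra_nat --> l.
Proof.
move=> uM.
have [|l [_ clu]] := @segment_compact R (- M) M (fmap u ultra_nat)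
    (fmap_proper_filter u _).
  apply: (@filterS _ ultra_nat _ setT _ _ filterT) => k _ /=.
  by rewrite in_itv /= -ler_norml.
exists l => A nA; case: (in_ultra_setVsetC (u @^-1` A) ultra_nat_ultra) => // UA.
by have [x []] := clu (~` A) A UA nA.
Qed.

Section MatrixLimits.
Variable R : realType.

(* Matrix limits are taken entrywise along one ultrafilter, so that every bounded
   sequence converges without passing to subsequences. *)
Definition mcvg p q (u : nat -> 'M[R]_(p, q)) (l : 'M[R]_(p, q)) :=
  forall i j, (fun k => u k i j) @ ultra_nat --> l i j.

Lemma mcvg_eventually p q (u : nat -> 'M[R]_(p, q)) (l : 'M[R]_(p, q)) :
  (forall i j, (fun k => u k i j) @ \oo --> l i j) -> mcvg u l.
Proof. by move=> ul i j; apply: cvg_ultra. Qed.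

Lemma mcvg_cst p q (l : 'M[R]_(p, q)) : mcvg (fun=> l) l.
Proof. by move=> i j; exact: cvg_cst. Qed.

Lemma mcvg_entry p q i j (u : nat -> 'M[R]_(p, q)) (l : 'M[R]_(p, q)) :
  mcvg u l -> (fun k => u k i j) @ ultra_nat --> l i j.
Proof. by move=> ul; exact: ul. Qed.

Lemma mcvg_near p q (u v : nat -> 'M[R]_(p, q)) (l : 'M[R]_(p, q)) :
  (\forall k \near \oo, u k = v k) -> mcvg u l -> mcvg v l.
Proof.
move=> uv ul i j; have := ul i j; apply: cvg_trans; apply: near_eq_cvg.
by apply: eventually_ultra; apply: filterS uv => k ->.
Qed.

Lemma mcvg_unique p q (u : nat -> 'M[R]_(p, q)) (l l' : 'M[R]_(p, q)) :
  mcvg u l -> mcvg u l' -> l = l'.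
Proof.
by move=> ul ul'; apply/matrixP => i j; apply: cvg_unique (ul i j) (ul' i j).
Qed.

Lemma mcvgD p q (u v : nat -> 'M[R]_(p, q)) (l m : 'M[R]_(p, q)) :
  mcvg u l -> mcvg v m -> mcvg (fun k => u k + v k) (l + m).
Proof.
move=> ul vm i j; rewrite mxE; under eq_fun do rewrite mxE.
exact: cvgD (ul i j) (vm i j).
Qed.

Lemma mcvgN p q (u : nat -> 'M[R]_(p, q)) (l : 'M[R]_(p, q)) :
  mcvg u l -> mcvg (fun k => - u k) (- l).
Proof.
move=> ul i j; rewrite mxE; under eq_fun do rewrite mxE.
exact: cvgN (ul i j).
Qed.

Lemma mcvgB p q (u v : nat -> 'M[R]_(p, q)) (l m : 'M[R]_(p, q)) :
  mcvg u l -> mcvg v m -> mcvg (fun k => u k - v k) (l - m).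
Proof. by move=> ul vm; apply: mcvgD ul (mcvgN vm). Qed.

Lemma mcvgZ p q (a : nat -> R) (u : nat -> 'M[R]_(p, q)) (b : R)
    (l : 'M[R]_(p, q)) :
  a @ ultra_nat --> b -> mcvg u l -> mcvg (fun k => a k *: u k) (b *: l).
Proof.
move=> ab ul i j; rewrite mxE; under eq_fun do rewrite mxE.
exact: cvgM ab (ul i j).
Qed.

Lemma cvg_fsum (T : Type) (F : set_system T) {FF : Filter F} (I : finType)
    (u : T -> I -> R) (l : I -> R) :
  (forall i, (fun k => u k i) @ F --> l i) ->
  (fun k => \sum_i u k i) @ F --> \sum_i l i.
Proof.
move=> ul; elim: (index_enum I) => [|i s IHs].
  by rewrite big_nil; under eq_fun do rewrite big_nil; exact: cvg_cst.
by rewrite big_cons; under eq_fun do rewrite big_cons; exact: cvgD (ul i) IHs.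
Qed.

Lemma mcvgM p q r (u : nat -> 'M[R]_(p, q)) (v : nat -> 'M[R]_(q, r))
    (l : 'M[R]_(p, q)) (m : 'M[R]_(q, r)) :
  mcvg u l -> mcvg v m -> mcvg (fun k => u k *m v k) (l *m m).
Proof.
move=> ul vm i j; rewrite mxE; under eq_fun do rewrite mxE.
by apply: cvg_fsum => s; exact: cvgM (ul i s) (vm s j).
Qed.

Lemma mcvg_tr p q (u : nat -> 'M[R]_(p, q)) (l : 'M[R]_(p, q)) :
  mcvg u l -> mcvg (fun k => (u k)^T) l^T.
Proof.
move=> ul i j; rewrite mxE; under eq_fun do rewrite mxE; exact: ul.
Qed.

Lemma cvg_mxtrace p (u : nat -> 'M[R]_p) (l : 'M[R]_p) :
  mcvg u l -> (fun k => \tr (u k)) @ ultra_nat --> \tr l.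
Proof. by move=> ul; apply: cvg_fsum => s; exact: ul. Qed.

Lemma mcvg_bounded p q (u : nat -> 'M[R]_(p, q)) (M : R) :
  (forall k i j, `|u k i j| <= M) -> exists l, mcvg u l.
Proof.
move=> uM.
have /(_ _ _)/cid c i j : exists l : R, (fun k => u k i j) @ ultra_nat --> l.
  by apply: (@ultra_bounded_cvg R _ M) => k.
exists (\matrix_(i, j) projT1 (c i j)) => i j; rewrite mxE.
exact: (projT2 (c i j)).
Qed.

Lemma ultra_le (u v : nat -> R) (l m : R) : u @ ultra_nat --> l ->
  v @ ultra_nat --> m -> (\forall k \near \oo, u k <= v k) -> l <= m.
Proof.
move=> ul vm uv; apply: (ler_cvg_to ul vm); exact: eventually_ultra.
Qed.

Lemma ultra_unique (u : nat -> R) (l m : R) :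
  u @ ultra_nat --> l -> u @ ultra_nat --> m -> l = m.
Proof. by move=> ul um; apply: cvg_unique ul um. Qed.

Lemma ultra_ge_cst (v : nat -> R) (c m : R) :
  v @ ultra_nat --> m -> (forall k, c <= v k) -> c <= m.
Proof.
by move=> vm cv; apply: ultra_le (cvg_cst c) vm _; apply: nearW => k; exact: cv.
Qed.

Lemma ultra_le_cst (v : nat -> R) (c m : R) :
  v @ ultra_nat --> m -> (forall k, v k <= c) -> m <= c.
Proof.
by move=> vm cv; apply: ultra_le vm (cvg_cst c) _; apply: nearW => k; exact: cv.
Qed.

End MatrixLimits.

Arguments mcvg_cst {R p q} l.
Arguments mcvg_entry {R p q} i j {u l}.

(** * Difference quotients along sequences *)

Lemma derive_seq (R : realType) (V W : normedModType R) (f : V -> W) (a v : V)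
    (h : nat -> R) : derivable f a v -> h @ \oo --> (0 : R) ->
  (forall k, h k != 0) ->
  (fun k => (h k)^-1 *: (f (h k *: v + a) - f a)) @ \oo --> 'D_v f a.
Proof.
move=> fav h0 hn0.
have hd : h @ \oo --> (0 : R)^'.
  move=> A nA; have H : \oo (h @^-1` [set x | x != 0 -> A x]) := h0 _ nA.
  by apply: (@filterS _ \oo _ _ _ _ H) => k; apply; exact: hn0.
pose q t := t^-1 *: ((f \o shift a) (t *: v) - f a).
exact: (@cvg_comp _ _ _ h q \oo _ _ hd fav).
Qed.

Lemma cvg_geometric2 (R : realType) (a : R) :
  (fun k => a / 2 ^+ k) @ \oo --> (0 : R).
Proof.
rewrite (_ : (fun k => _) = geometric a 2^-1); last first.
  by apply/funext => k; rewrite /geometric /= exprVn.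
by apply: cvg_geometric; rewrite ger0_norm// invf_lt1// ltr1n.
Qed.

(** The dyadic scale is that of the infinitesimal automorphisms; applied to [cos] and [sin], this
    compares one small step with a rotation. *)
Lemma cvg_pow2_derive (R : realType) (V : normedModType R) (f : R -> V)
    (a : R) (df : V) : is_derive (0 : R) (1 : R) f df -> a != 0 ->
  (fun k => 2 ^+ k *: (f (a / 2 ^+ k) - f 0)) @ \oo --> a *: df.
Proof.
move=> fd a0.
have n0 k : a / 2 ^+ k != 0 by rewrite mulf_neq0// invr_neq0// expf_neq0.
have := derive_seq (@ex_derive _ _ _ _ _ _ _ fd) (cvg_geometric2 a) n0.
rewrite derive_val => /(cvgZl_tmp (k := a)).
apply: cvg_trans; apply: near_eq_cvg; apply: nearW => k /=.
rewrite addr0 scalerA -[_ *: 1]/(_ * 1) mulr1; congr (_ *: _).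
by rewrite invfM invrK mulrA mulfV// mul1r.
Qed.

(** * The Frobenius norm and invariant forms *)

Lemma discr_le (R : realFieldType) (a b c : R) : 0 <= c ->
  (forall t, 0 <= a + t * b *+ 2 + t ^+ 2 * c) -> b ^+ 2 <= a * c.
Proof.
rewrite le_eqVlt => /orP[/eqP <- P|c0 /(_ (- b / c))].
  have [->|b0] := eqVneq b 0; first by rewrite expr0n mulr0.
  (* Here the leading coefficient is zero, and [t] is chosen to give the affine function the value
     -1. *)
  have := P (- (a + 1) / b / 2); suff -> : a + - (a + 1) / b / 2 * b *+ 2 +
    (- (a + 1) / b / 2) ^+ 2 * 0 = -1 by lra.
  by field.
have -> : a + - b / c * b *+ 2 + (- b / c) ^+ 2 * c = (a * c - b ^+ 2) / c.
  by field; rewrite gt_eqF.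
by rewrite pmulr_lge0 ?invr_gt0// subr_ge0.
Qed.

Lemma cauchy_schwarz_sum (R : realFieldType) (I : finType) (a b : I -> R) :
  (\sum_i a i * b i) ^+ 2 <= (\sum_i a i ^+ 2) * (\sum_i b i ^+ 2).
Proof.
apply: discr_le => [|t]; first by apply: sumr_ge0 => i _; exact: sqr_ge0.
rewrite mulr_sumr -sumrMnl mulr_sumr -!big_split /=.
apply: sumr_ge0 => i _.
suff -> : a i ^+ 2 + t * (a i * b i) *+ 2 + t ^+ 2 * b i ^+ 2 =
  (a i + t * b i) ^+ 2 by exact: sqr_ge0.
by ring.
Qed.

Section Frobenius.
Variable R : realType.

Definition frob p q (A : 'M[R]_(p, q)) : R := \sum_i \sum_j A i j ^+ 2.

Definition nrm p q (A : 'M[R]_(p, q)) : R := Num.sqrt (frob A).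

Lemma frobE p q (A : 'M[R]_(p, q)) : frob A = \tr (A *m A^T).
Proof.
apply: eq_bigr => i _; rewrite mxE; apply: eq_bigr => j _.
by rewrite mxE expr2.
Qed.

Lemma frob_ge0 p q (A : 'M[R]_(p, q)) : 0 <= frob A.
Proof. by apply: sumr_ge0 => i _; apply: sumr_ge0 => j _; exact: sqr_ge0. Qed.

Lemma sqr_nrm p q (A : 'M[R]_(p, q)) : nrm A ^+ 2 = frob A.
Proof. by rewrite sqr_sqrtr ?frob_ge0. Qed.

Lemma nrm_ge0 p q (A : 'M[R]_(p, q)) : 0 <= nrm A.
Proof. exact: sqrtr_ge0. Qed.

Lemma nrm_leE p q (A : 'M[R]_(p, q)) M : 0 <= M ->
  (nrm A <= M) = (frob A <= M ^+ 2).
Proof. by move=> M0; rewrite -sqr_nrm ler_sqr// nnegrE nrm_ge0. Qed.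

Lemma entry_le_nrm p q (A : 'M[R]_(p, q)) i j : `|A i j| <= nrm A.
Proof.
rewrite -(ler_sqr (normr_ge0 _) (nrm_ge0 _)) sqr_nrm real_normK ?num_real//.
rewrite /frob (bigD1 i)//= (bigD1 j)//= -addrA lerDl addr_ge0//.
  by apply: sumr_ge0 => k _; exact: sqr_ge0.
by apply: sumr_ge0 => l _; apply: sumr_ge0 => k _; exact: sqr_ge0.
Qed.

Lemma nrm_eq0 p q (A : 'M[R]_(p, q)) : nrm A = 0 -> A = 0.
Proof.
move=> A0; apply/matrixP => i j; apply/eqP; rewrite mxE -normr_le0 -A0.
exact: entry_le_nrm.
Qed.

Lemma frob_eq0 p q (A : 'M[R]_(p, q)) : frob A = 0 -> A = 0.
Proof. by move=> A0; apply: nrm_eq0; rewrite /nrm A0 sqrtr0. Qed.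

Lemma nrmZ p q a (A : 'M[R]_(p, q)) : nrm (a *: A) = `|a| * nrm A.
Proof.
rewrite /nrm -sqrtr_sqr -sqrtrM ?sqr_ge0//; congr Num.sqrt.
rewrite /frob mulr_sumr; apply: eq_bigr => i _; rewrite mulr_sumr.
by apply: eq_bigr => j _; rewrite mxE exprMn.
Qed.

Lemma nrm0 p q : nrm (0 : 'M[R]_(p, q)) = 0.
Proof. by rewrite -(scale0r 0) nrmZ normr0 mul0r. Qed.

Lemma nrmN p q (A : 'M[R]_(p, q)) : nrm (- A) = nrm A.
Proof. by rewrite -scaleN1r nrmZ normrN1 mul1r. Qed.

Lemma nrmBC p q (A B : 'M[R]_(p, q)) : nrm (A - B) = nrm (B - A).
Proof. by rewrite -nrmN opprB. Qed.

Lemma nrmD p q (A B : 'M[R]_(p, q)) : nrm (A + B) <= nrm A + nrm B.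
Proof.
rewrite nrm_leE ?addr_ge0 ?nrm_ge0// sqrrD !sqr_nrm /frob !pair_big /=.
set S := \sum_p0 (A p0.1 p0.2 * B p0.1 p0.2).
have S2 : S ^+ 2 <= (nrm A * nrm B) ^+ 2.
  by rewrite exprMn !sqr_nrm /frob !pair_big; exact: cauchy_schwarz_sum.
have AB0 : 0 <= nrm A * nrm B by rewrite mulr_ge0 ?nrm_ge0.
have SAB : S <= nrm A * nrm B.
  have [S0|S0] := lerP S 0; first exact: le_trans S0 AB0.
  by move: S2; rewrite ler_sqr ?nnegrE ?(ltW S0).
rewrite (_ : \sum_p0 _ = \sum_p0 A p0.1 p0.2 ^+ 2 + S *+ 2 +
    \sum_p0 B p0.1 p0.2 ^+ 2); last first.
  rewrite -sumrMnl -!big_split; apply: eq_bigr => i _ /=.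
  by rewrite mxE sqrrD.
by rewrite lerD2r lerD2l lerMn2r.
Qed.

Lemma nrmM p q r (A : 'M[R]_(p, q)) (B : 'M[R]_(q, r)) :
  nrm (A *m B) <= nrm A * nrm B.
Proof.
rewrite nrm_leE ?mulr_ge0 ?nrm_ge0// exprMn !sqr_nrm.
rewrite [X in _ * X]/frob exchange_big /= big_distrl /=.
apply: ler_sum => i _; rewrite big_distrr /=; apply: ler_sum => j _.
by rewrite mxE; exact: cauchy_schwarz_sum.
Qed.

Lemma nrm_tr p q (A : 'M[R]_(p, q)) : nrm A^T = nrm A.
Proof.
rewrite /nrm /frob exchange_big /=; congr Num.sqrt.
by apply: eq_bigr => i _; apply: eq_bigr => j _; rewrite mxE.
Qed.

Lemma cvg_nrm (T : Type) (F : set_system T) {FF : Filter F} p q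
    (u : T -> 'M[R]_(p, q)) (l : 'M[R]_(p, q)) :
  (forall i j, (fun t => u t i j) @ F --> l i j) ->
  (fun t => nrm (u t)) @ F --> nrm l.
Proof.
move=> ul; apply: (@continuous_cvg _ _ _ _ _ _ Num.sqrt).
  exact: sqrt_continuous.
apply: cvg_fsum => i; apply: cvg_fsum => j.
by rewrite expr2; under eq_fun do rewrite expr2; exact: cvgM.
Qed.

Lemma nrm_mcvg p q (u : nat -> 'M[R]_(p, q)) (l : 'M[R]_(p, q)) :
  mcvg u l -> (fun k => nrm (u k)) @ ultra_nat --> nrm l.
Proof. exact: cvg_nrm. Qed.

Lemma nrm_bounded_mcvg p q (u : nat -> 'M[R]_(p, q)) (M : R) :
  (forall k, nrm (u k) <= M) -> exists l, mcvg u l.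
Proof.
by move=> uM; apply: (mcvg_bounded (M := M)) => k i j;
  apply: le_trans (entry_le_nrm _ _ _) (uM k).
Qed.

Lemma mcvg_nrm_le p q (u : nat -> 'M[R]_(p, q)) (l : 'M[R]_(p, q)) (e : nat -> R) :
  e @ ultra_nat --> 0 -> (forall k, nrm (u k - l) <= e k) -> mcvg u l.
Proof.
move=> e0 ule i j; apply/cvgrPdist_le => d d0.
move/cvgrPdist_le: e0 => /(_ d d0); apply: filterS => k; rewrite sub0r normrN => ed.
rewrite distrC.
have := entry_le_nrm (u k - l) i j; rewrite !mxE => /le_trans; apply.
by apply: le_trans (ule k) _; apply: le_trans ed; exact: ler_norm.
Qed.

End Frobenius.

(** * Positive definite matrices *)

Section PositiveForms.
Variable R : realType.

Definition posdef n (Q : 'M[R]_n) : Prop :=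
  Q^T = Q /\ forall x : 'rV[R]_n, x != 0 -> 0 < (x *m Q *m x^T) 0 0.

(** Elimination of the first coordinate: the corner entry is positive and has a square root, and the
    Schur complement of the corner is again positive definite. *)
Lemma cholesky n (Q : 'M[R]_n) : posdef Q ->
  exists2 S : 'M[R]_n, S \in unitmx & Q = S *m S^T.
Proof.
elim: n Q => [|n IHn] Q [Qsym Qpos].
  by exists 1%:M; [exact: unitmx1|apply/matrixP => -[]].
rewrite -[n.+1]/(1 + n)%N in Q Qsym Qpos *.
set a := Q 0 0; set b := ursubmx Q; set D := drsubmx Q.
have Qblock : Q = block_mx a%:M b b^T D.
  rewrite -[LHS]submxK; congr block_mx; last by rewrite -Qsym trmx_ursub.
  by apply/matrixP => i j; rewrite !ord1 !mxE /= mulr1n; congr (Q _ _); exact: val_inj.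
have Dsym : D^T = D by rewrite /D -[in RHS]Qsym trmx_drsub.
have qE (x : 'M[R]_1) (y : 'rV[R]_n) :
    row_mx x y *m Q *m (row_mx x y)^T =
    (x *m a%:M + y *m b^T) *m x^T + (x *m b + y *m D) *m y^T.
  by rewrite Qblock mul_row_block tr_row_mx mul_row_col.
have a_gt0 : 0 < a.
  have := Qpos (row_mx 1 0); rewrite qE !mul0mx !addr0 trmx0 mulmx0 addr0.
  rewrite mul1mx trmx1 mulmx1 mxE eqxx mulr1n; apply.
  apply/eqP => /(congr1 lsubmx); rewrite row_mxKl linear0.
  by move=> /matrixP/(_ 0 0)/eqP; rewrite !mxE oner_eq0.
have a_neq0 : a != 0 by rewrite gt_eqF.
set s := Num.sqrt a.
have s_neq0 : s != 0 by rewrite sqrtr_eq0 -ltNge.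
have ssE : s * s = a by rewrite -expr2 sqr_sqrtr ?ltW.
pose u : 'rV[R]_n := s^-1 *: b.
have [S' S'unit D'E] : exists2 S : 'M[R]_n, S \in unitmx & D - u^T *m u = S *m S^T.
  apply: IHn; split=> [|y y_neq0].
    by rewrite linearB /= trmx_mul trmxK Dsym.
  (* This [x] cancels the first component of [(x, y) *m Q], so that the value of [Q] at [(x, y)] is
     that of the Schur complement at [y]. *)
  pose x : 'M[R]_1 := - a^-1 *: (y *m b^T).
  have := Qpos (row_mx x y); rewrite qE.
  have -> : x *m a%:M + y *m b^T = 0.
    by rewrite mul_mx_scalar scalerA mulrN mulfV// scaleN1r addNr.
  rewrite mul0mx add0r; suff -> : x *m b + y *m D = y *m (D - u^T *m u).
    apply; apply/eqP => /(congr1 rsubmx); rewrite row_mxKr linear0.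
    by move/eqP; rewrite (negbTE y_neq0).
  have -> : u^T *m u = a^-1 *: (b^T *m b).
    by rewrite /u [(_ *: b)^T]linearZ /= -scalemxAl -scalemxAr scalerA -invfM ssE.
  by rewrite mulmxBr addrC /x -scalemxAl -scalemxAr scaleNr mulmxA.
exists (block_mx s%:M 0 u^T S').
  by rewrite unitmxE det_lblock det_scalar1 unitrM unitfE s_neq0 -unitmxE.
rewrite tr_block_mx mulmx_block tr_scalar_mx !trmx0 trmxK !mul0mx !addr0.
rewrite !mulmx0 !addr0 -D'E addrC subrK -scalar_mxM ssE {1}Qblock.
congr block_mx; first by rewrite mul_scalar_mx scalerA mulfV// scale1r.
by rewrite linearZ /= -scalemxAl mul_mx_scalar scalerA mulVf// scale1r.
Qed.

(* Instead of averaging over the group: [P |-> sup_g |g P g^T|] is an invariant,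
   strictly convex function on the invariant convex set [D], so that its minimiser
   is unique and hence invariant. *)
Lemma invariant_form n (Gam : set 'M[R]_n) (M : R) :
  Gam 1%:M -> (forall g h, Gam g -> Gam h -> Gam (g *m h)) ->
  (forall g, Gam g -> g \in unitmx /\ Gam (invmx g)) ->
  (forall g, Gam g -> nrm g <= M) ->
  exists2 P, posdef P & forall g, Gam g -> g *m P *m g^T = P.
Proof.
move=> Gam1 GamM GamV GamB.
(* The lower bound keeps limits positive definite; asking it for every [g] makes [D] invariant under
   the group. *)
pose D (P : 'M[R]_n) := P^T = P /\ forall (x : 'rV[R]_n) g, Gam g ->
  frob (x *m g) <= (x *m P *m x^T) 0 0.
pose E r P := D P /\ forall g, Gam g -> frob (g *m P *m g^T) <= r.
have M0 : 0 <= M by apply: le_trans (GamB _ Gam1); exact: nrm_ge0.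
have xxE (x : 'rV[R]_n) : (x *m x^T) 0 0 = frob x.
  by rewrite frobE /mxtrace big_ord1.
pose r0 := (M ^+ 2 * (M * M)) ^+ 2.
have E0 : E r0 (M ^+ 2)%:M.
  split; first split; first by rewrite tr_scalar_mx.
    move=> x g gG; rewrite mul_mx_scalar -scalemxAl mxE xxE -!sqr_nrm -exprMn.
    rewrite ler_sqr ?nnegrE ?mulr_ge0 ?nrm_ge0// mulrC.
    apply: le_trans (nrmM _ _) _; rewrite ler_wpM2l ?nrm_ge0 ?GamB//.
  move=> g gG; rewrite -sqr_nrm ler_sqr ?nnegrE ?mulr_ge0 ?sqr_ge0 ?nrm_ge0//.
  rewrite -scalemx1 -scalemxAr mulmx1 -scalemxAl nrmZ ger0_norm ?sqr_ge0//.
  rewrite ler_wpM2l ?sqr_ge0// (le_trans (nrmM _ _))// ler_pM ?nrm_ge0 ?nrm_tr ?GamB//.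
have Ege0 r P : E r P -> 0 <= r.
  by case=> _ /(_ _ Gam1); apply: le_trans; exact: frob_ge0.
pose m := inf [set r | exists P, E r P].
have hasinf : has_inf [set r | exists P, E r P].
  by split; [exists r0, (M ^+ 2)%:M|exists 0 => r [P /Ege0]].
have /(_ _)/cid Pk k : exists P, E (m + k.+1%:R^-1) P.
  have k0 : (0 : R) < k.+1%:R^-1 by rewrite invr_gt0.
  have [r [P [DP PB]] rm] := inf_adherent k0 hasinf.
  exists P; split=> // g gG; apply: le_trans (PB g gG) (ltW rm).
pose u k := projT1 (Pk k).
have [uD uE] : (forall k, D (u k)) /\
    (forall k g, Gam g -> frob (g *m u k *m g^T) <= m + k.+1%:R^-1).
  by split=> k; case: (projT2 (Pk k)).
have inv0 : (fun k => m + k.+1%:R^-1) @ ultra_nat --> m.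
  apply: cvg_ultra; rewrite -[X in _ --> X]addr0.
  by apply: cvgD; [exact: cvg_cst|exact: cvg_harmonic].
have [P uP] : exists P, mcvg u P.
  apply: (nrm_bounded_mcvg (M := Num.sqrt (m + 1))) => k; rewrite /nrm.
  rewrite ler_wsqrtr// (le_trans _ (le_trans (uE k _ Gam1) _))//.
    by rewrite mul1mx trmx1 mulmx1.
  by rewrite lerD2l invf_le1// ler1n.
have DP : D P.
  split=> [|x g gG].
    apply: mcvg_unique (uP); move: (mcvg_tr uP).
    by under eq_fun do rewrite (proj1 (uD _)).
  have := mcvgM (mcvgM (mcvg_cst x) uP) (mcvg_cst x^T).
  move=> /(mcvg_entry 0 0)/ultra_ge_cst; apply.
  by move=> k; exact: (proj2 (uD k)).
have EP : E m P.
  split=> // g gG; rewrite -sqr_nrm.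
  have := nrm_mcvg (mcvgM (mcvgM (mcvg_cst g) uP) (mcvg_cst g^T)).
  move=> h; apply: (ultra_le (cvgM h h) inv0).
  by apply: nearW => k /=; rewrite -expr2 sqr_nrm; exact: uE.
exists P => [|h hG].
  split=> [|x x0]; first by case: DP.
  apply: lt_le_trans (proj2 DP x _ Gam1); rewrite mulmx1 lt_def frob_ge0 andbT.
  by apply: contra_neq x0 => /frob_eq0.
pose P' := h *m P *m h^T.
have DP' : D P'.
  split=> [|x g gG]; first by rewrite !trmx_mul trmxK (proj1 DP) mulmxA.
  have /GamV [hu _] := hG.
  have := proj2 DP (x *m h) _ (GamM _ _ (proj2 (GamV _ hG)) gG).
  by rewrite mulmxA mulmxK// trmx_mul !mulmxA.
have EP' g : Gam g -> frob (g *m P' *m g^T) <= m.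
  move=> gG; have := proj2 EP _ (GamM _ _ gG hG).
  by rewrite trmx_mul !mulmxA.
pose Z := P' - P.
have ZB g : Gam g -> frob Z <= M ^+ 4 * frob (g *m Z *m g^T).
  move=> gG; have [gu gV] := GamV _ gG.
  have {1}-> : Z = invmx g *m (g *m Z *m g^T) *m (invmx g)^T.
    by rewrite !mulmxA mulVmx// mul1mx -mulmxA -trmx_mul mulVmx// trmx1 mulmx1.
  rewrite -!sqr_nrm (_ : M ^+ 4 = (M * M) ^+ 2); last by ring.
  rewrite -exprMn ler_sqr ?nnegrE ?mulr_ge0 ?nrm_ge0// mulrAC.
  rewrite (le_trans (nrmM _ _))// ler_pM ?nrm_ge0//; last by rewrite nrm_tr GamB.
  by rewrite (le_trans (nrmM _ _))// ler_wpM2r ?nrm_ge0 ?GamB.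
(* By the parallelogram identity the midpoint lowers each energy by a quarter of
   [frob (g *m Z *m g^T)], which [ZB] bounds below uniformly in [g]. The summand 1 in [d] keeps the
   denominator positive. *)
pose Q := 2^-1 *: (P + P').
pose d := frob Z / (4 * (M ^+ 4 + 1)).
have M4 : 0 < M ^+ 4 + 1 by rewrite ltr_wpDl ?exprn_ge0.
have EQ : E (m - d) Q.
  split; first split.
  - by rewrite /Q linearZ /= linearD /= (proj1 DP) (proj1 DP').
  - move=> x g gG; rewrite -scalemxAr mulmxDr -scalemxAl mulmxDl.
    rewrite mxE [X in _ * X]mxE.
    by have := proj2 DP x g gG; have := proj2 DP' x g gG; lra.
  - move=> g gG.
    have : frob (g *m Q *m g^T) = (frob (g *m P *m g^T) +
       frob (g *m P' *m g^T)) / 2 - frob (g *m Z *m g^T) / 4.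
      have -> : g *m Q *m g^T = 2^-1 *: (g *m P *m g^T + g *m P' *m g^T).
        by rewrite -scalemxAr mulmxDr -scalemxAl mulmxDl.
      have -> : g *m Z *m g^T = g *m P' *m g^T - g *m P *m g^T.
        by rewrite mulmxBr mulmxBl.
      move: (g *m P *m g^T) (g *m P' *m g^T) => A B; rewrite /frob.
      rewrite -big_split !mulr_suml -sumrB; apply: eq_bigr => i _ /=.
      rewrite -big_split !mulr_suml -sumrB; apply: eq_bigr => j _ /=.
      by rewrite !mxE; field.
    have dB : d <= frob (g *m Z *m g^T) / 4.
      rewrite /d invfM mulrA ler_pdivrMr// [in leRHS]mulrAC.
      rewrite ler_wpM2r ?invr_ge0// (le_trans (ZB _ gG))//.
      by rewrite mulrC ler_wpM2l ?frob_ge0// lerDl.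
    have := proj2 EP g gG; have := EP' g gG => h1 h2 h3.
    rewrite h3; lra.
have : m <= m - d by apply: ge_inf; [case: hasinf|exists Q].
rewrite lerDl oppr_ge0 /d pmulr_lle0 ?invr_gt0 ?mulr_gt0// => Z0.
apply/eqP; rewrite -subr_eq0; apply/eqP/frob_eq0/eqP.
by rewrite eq_le Z0 frob_ge0.
Qed.

End PositiveForms.

(** * Compact Lie algebras *)

Section CompactLieAlgebra.
Variables (R : realType) (n : nat) (br : 'rV[R]_n -> 'rV[R]_n -> 'rV[R]_n).
Implicit Types (x y z u v : 'rV[R]_n) (A B psi phi : 'M[R]_n).

(* Matrices act on row vectors from the right, so that [v *m ad x = br x v] and
   [psi *m phi] applies [psi] first. *)

Hypothesis brl : forall a x y z, br (a *: x + y) z = a *: br x z + br y z.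
Hypothesis brC : forall x y, br x y = - br y x.
Hypothesis brJ : forall z x y, br z (br x y) = br (br z x) y + br x (br z y).
Hypothesis dot_gt0 : forall x, x != 0 -> 0 < killing_dot br x x.

Local Notation dot := (killing_dot br).
Local Notation ad := (ad br).

Lemma brr a x y z : br z (a *: x + y) = a *: br z x + br z y.
Proof. by rewrite brC brl (brC z x) (brC z y) scalerN opprD. Qed.

Lemma brDl x y z : br (x + y) z = br x z + br y z.
Proof. by rewrite -[x]scale1r brl !scale1r. Qed.

Lemma br0l z : br 0 z = 0.
Proof. by apply: (@addIr _ (br 0 z)); rewrite -brDl !add0r. Qed.

Lemma brZl a x z : br (a *: x) z = a *: br x z.
Proof. by rewrite -[a *: x]addr0 brl br0l addr0. Qed.

Lemma brNl x z : br (- x) z = - br x z.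
Proof. by rewrite -scaleN1r brZl scaleN1r. Qed.

Lemma brDr x y z : br z (x + y) = br z x + br z y.
Proof. by rewrite -[x]scale1r brr !scale1r. Qed.

Lemma br0r z : br z 0 = 0.
Proof. by rewrite brC br0l oppr0. Qed.

Lemma brZr a x z : br z (a *: x) = a *: br z x.
Proof. by rewrite brC brZl (brC z x) scalerN. Qed.

Lemma brNr x z : br z (- x) = - br z x.
Proof. by rewrite brC brNl (brC z). Qed.

Lemma brBr x y z : br z (x - y) = br z x - br z y.
Proof. by rewrite brDr brNr. Qed.

Lemma brBl x y z : br (x - y) z = br x z - br y z.
Proof. by rewrite brDl brNl. Qed.

Lemma brxx x : br x x = 0.
Proof.
have /eqP := brC x x; rewrite -addr_eq0 -mulr2n -scaler_nat scaler_eq0.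
by rewrite pnatr_eq0 => /eqP.
Qed.

Lemma mul_ad v x : v *m ad x = br x v.
Proof.
rewrite /ad mulmx_sum_row [in RHS](row_sum_delta v).
have -> : br x (\sum_j v 0 j *: delta_mx 0 j) = \sum_j v 0 j *: br x (delta_mx 0 j).
  elim: (index_enum _) => [|j s IHs]; first by rewrite !big_nil br0r.
  by rewrite !big_cons brr IHs.
apply: eq_bigr => i _; congr (_ *: _); apply/rowP => j.
by rewrite !mxE.
Qed.

Lemma mulmx_eqP A B : (forall v, v *m A = v *m B) -> A = B.
Proof. by move=> AB; apply/row_matrixP => i; rewrite !rowE. Qed.

Lemma ad_lin a x y : ad (a *: x + y) = a *: ad x + ad y.
Proof.
apply: mulmx_eqP => v; rewrite mulmxDr -scalemxAr !mul_ad; exact: brl.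
Qed.

Lemma ad_br x y : ad (br x y) = ad y *m ad x - ad x *m ad y.
Proof.
apply: mulmx_eqP => v; rewrite mulmxBr !mulmxA !mul_ad [in RHS]brJ.
by rewrite addrK.
Qed.

Lemma dotC x y : dot x y = dot y x.
Proof. by rewrite /killing_dot /killing mxtrace_mulC. Qed.

Lemma dot_lin a x y z : dot (a *: x + y) z = a * dot x z + dot y z.
Proof.
rewrite /killing_dot /killing ad_lin mulmxDl -scalemxAl mxtraceD mxtraceZ.
by rewrite opprD mulrN.
Qed.

Lemma dotDl x y z : dot (x + y) z = dot x z + dot y z.
Proof. by rewrite -[x]scale1r dot_lin mul1r scale1r. Qed.

Lemma dot0l z : dot 0 z = 0.
Proof. by apply: (@addIr _ (dot 0 z)); rewrite -dotDl !add0r. Qed.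

Lemma dotZl a x z : dot (a *: x) z = a * dot x z.
Proof. by rewrite -[a *: x]addr0 dot_lin dot0l addr0. Qed.

Lemma dotNl x z : dot (- x) z = - dot x z.
Proof. by rewrite -scaleN1r dotZl mulN1r. Qed.

Lemma dotBl x y z : dot (x - y) z = dot x z - dot y z.
Proof. by rewrite dotDl dotNl. Qed.

Lemma dot0r z : dot z 0 = 0.
Proof. by rewrite dotC dot0l. Qed.

Lemma dotDr x y z : dot z (x + y) = dot z x + dot z y.
Proof. by rewrite !(dotC z) dotDl. Qed.

Lemma dotZr a x z : dot z (a *: x) = a * dot z x.
Proof. by rewrite !(dotC z) dotZl. Qed.

Lemma dotNr x z : dot z (- x) = - dot z x.
Proof. by rewrite !(dotC z) dotNl. Qed.

Lemma dot_ge0 x : 0 <= dot x x.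
Proof. by have [->|/dot_gt0/ltW//] := eqVneq x 0; rewrite dot0l. Qed.

Lemma dot_eq0 x : dot x x = 0 -> x = 0.
Proof. by have [//|/dot_gt0 + x0] := eqVneq x 0; rewrite x0 ltxx. Qed.

Lemma dot_br x y z : dot (br z x) y = - dot x (br z y).
Proof.
rewrite /killing_dot /killing !ad_br mulmxBl mulmxBr !linearB /= opprK.
rewrite -!mulmxA (mxtrace_mulC (ad z)) -!mulmxA.
by rewrite !opprK addrC.
Qed.

(** [ad x] is skew for a definite form, so its square has the same kernel. This stands in for
    semisimplicity of the operator [ad x]. *)
Lemma br_br_eq0 x y : br x (br x y) = 0 -> br x y = 0.
Proof. by move=> xxy; apply: dot_eq0; rewrite dot_br xxy dot0r oppr0. Qed.

(** * Orthonormal coordinates for the Killing form and their norms *)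

Definition gram : 'M[R]_n := \matrix_(i, j) dot (delta_mx 0 i) (delta_mx 0 j).

Lemma dot_gram x y : dot x y = (x *m gram *m y^T) 0 0.
Proof.
have dsum v (c : 'I_n -> R) : dot (\sum_j c j *: delta_mx 0 j) v =
    \sum_j c j * dot (delta_mx 0 j) v.
  elim: (index_enum _) => [|j s IHs]; first by rewrite !big_nil dot0l.
  by rewrite !big_cons dot_lin IHs.
rewrite {1}(row_sum_delta x) dsum -mulmxA mxE; apply: eq_bigr => i _.
congr (_ * _); rewrite {1}(row_sum_delta y) dotC dsum mxE.
by apply: eq_bigr => j _; rewrite !mxE mulrC dotC.
Qed.

Lemma posdef_gram : posdef gram.
Proof.
split=> [|x x0]; first by apply/matrixP => i j; rewrite !mxE dotC.
by rewrite -dot_gram dot_gt0.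
Qed.

Definition gram_root : 'M[R]_n :=
  projT1 (cid (let: ex_intro2 T Tu TE := cholesky posdef_gram in
    ex_intro (fun T => T \in unitmx /\ gram = T *m T^T) T (conj Tu TE))).

Local Notation S := gram_root.

Lemma gram_rootP : S \in unitmx /\ gram = S *m S^T.
Proof. by rewrite /gram_root; case: cid. Qed.

Lemma gram_root_unit : S \in unitmx. Proof. by case: gram_rootP. Qed.

Definition vnorm x := nrm (x *m S).
(** The Frobenius norm in orthonormal coordinates. Automorphisms are orthogonal there, so
    multiplying by one on either side is an isometry. *)
Definition mnorm A := nrm (invmx S *m A *m S).

Lemma sqr_vnorm x : vnorm x ^+ 2 = dot x x.
Proof.
rewrite sqr_nrm frobE trmx_mul dot_gram (proj2 gram_rootP) /mxtrace big_ord1.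
by rewrite !mulmxA.
Qed.

Lemma vnorm_eq0 x : vnorm x = 0 -> x = 0.
Proof. by move=> x0; apply: dot_eq0; rewrite -sqr_vnorm x0 expr0n. Qed.

Lemma vnorm0 : vnorm 0 = 0.
Proof. by rewrite /vnorm mul0mx nrm0. Qed.

Lemma vnormZ a x : vnorm (a *: x) = `|a| * vnorm x.
Proof. by rewrite /vnorm -scalemxAl nrmZ. Qed.

Lemma vnormD x y : vnorm (x + y) <= vnorm x + vnorm y.
Proof. by rewrite /vnorm mulmxDl nrmD. Qed.

Lemma vnormM x A : vnorm (x *m A) <= vnorm x * mnorm A.
Proof.
rewrite /vnorm /mnorm (le_trans _ (nrmM _ _))// !mulmxA mulmxK//.
exact: gram_root_unit.
Qed.

Lemma mnorm_ge0 A : 0 <= mnorm A. Proof. exact: nrm_ge0. Qed.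

Lemma mnormZ a A : mnorm (a *: A) = `|a| * mnorm A.
Proof. by rewrite /mnorm -scalemxAr -scalemxAl nrmZ. Qed.

Lemma mnormD A B : mnorm (A + B) <= mnorm A + mnorm B.
Proof. by rewrite /mnorm mulmxDr mulmxDl nrmD. Qed.

Lemma mnorm0 : mnorm 0 = 0.
Proof. by rewrite /mnorm mulmx0 mul0mx nrm0. Qed.

Lemma mnorm_eq0 A : mnorm A = 0 -> A = 0.
Proof.
move=> /nrm_eq0 A0; have Su := gram_root_unit.
rewrite -[A]mul1mx -(mulmxV Su) -[A]mulmx1 -(mulmxV Su) -!mulmxA.
by rewrite (mulmxA _ A) (mulmxA _ S) A0 mul0mx mulmx0.
Qed.

Lemma mnorm_bounded (u : nat -> 'M[R]_n) (M : R) :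
  (forall k, mnorm (u k) <= M) -> exists l, mcvg u l.
Proof.
move=> /nrm_bounded_mcvg[l ul]; exists (S *m l *m invmx S).
have := mcvgM (mcvgM (mcvg_cst S) ul) (mcvg_cst (invmx S)).
have Su := gram_root_unit.
rewrite (_ : (fun k => _) = u)//; apply/funext => k.
by rewrite !mulmxA mulmxK// mulmxV// mul1mx.
Qed.

Lemma cvg_mnorm (u : nat -> 'M[R]_n) (l : 'M[R]_n) :
  mcvg u l -> (fun k => mnorm (u k)) @ ultra_nat --> mnorm l.
Proof.
by move=> ul; apply: nrm_mcvg; apply: mcvgM (mcvg_cst S); apply: mcvgM ul;
  exact: mcvg_cst.
Qed.

(** * Automorphisms of the bracket and of the form *)

Definition lie_aut psi : Prop :=
  (forall x y, br (x *m psi) (y *m psi) = br x y *m psi) /\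
  psi *m gram *m psi^T = gram.

(** The adjoint for [dot], hence the inverse of an automorphism. It is linear in [psi], so
    difference quotients of inverses are read off those of the automorphisms. *)
Definition lie_inv psi : 'M[R]_n := gram *m psi^T *m invmx gram.

Lemma gram_unit : gram \in unitmx.
Proof.
have [Su ->] := gram_rootP; rewrite unitmx_mul Su /=.
by rewrite unitmx_tr.
Qed.

Lemma mul_lie_inv psi : lie_aut psi -> psi *m lie_inv psi = 1%:M.
Proof.
by case=> _ psiQ; rewrite /lie_inv !mulmxA psiQ mulmxV// gram_unit.
Qed.

Lemma lie_inv_mul psi : lie_aut psi -> lie_inv psi *m psi = 1%:M.
Proof. by move/mul_lie_inv/mulmx1C. Qed.

Lemma lie_aut1 : lie_aut 1%:M.
Proof. by split=> [x y|]; rewrite ?mulmx1// trmx1 mulmx1 mul1mx. Qed.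

Lemma lie_autM psi phi : lie_aut psi -> lie_aut phi -> lie_aut (psi *m phi).
Proof.
move=> [psih psiQ] [phih phiQ]; split=> [x y|].
  by rewrite !mulmxA phih psih.
by rewrite trmx_mul !mulmxA -(mulmxA psi) -(mulmxA psi) phiQ.
Qed.

Lemma lie_autX psi k : lie_aut psi -> lie_aut (psi ^+ k).
Proof.
move=> psiA; elim: k => [|k IHk]; first by rewrite expr0; exact: lie_aut1.
by rewrite exprS; exact: lie_autM.
Qed.

Lemma lie_autV psi : lie_aut psi -> lie_aut (lie_inv psi).
Proof.
move=> psiA; have [h psiQ] := psiA; split=> [x y|].
  have xE v : v = v *m lie_inv psi *m psi.
    by rewrite -mulmxA lie_inv_mul// mulmx1.
  rewrite {2}(xE x) {2}(xE y) h -[in RHS]mulmxA mul_lie_inv//.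
  by rewrite mulmx1.
have := lie_inv_mul psiA; move: (lie_inv psi) => phi phipsi.
rewrite -[in LHS]psiQ !mulmxA phipsi mul1mx -mulmxA -trmx_mul phipsi.
by rewrite trmx1 mulmx1.
Qed.

Lemma dot_aut psi x y : lie_aut psi -> dot (x *m psi) (y *m psi) = dot x y.
Proof.
case=> _ psiQ; rewrite !dot_gram trmx_mul !mulmxA.
by rewrite -(mulmxA x psi) -(mulmxA x (psi *m gram)) psiQ.
Qed.

Lemma vnorm_aut psi x : lie_aut psi -> vnorm (x *m psi) = vnorm x.
Proof.
move=> psiA; apply/eqP; rewrite -(eqrXn2 (_ : 0 < 2)%N) ?nrm_ge0//.
by rewrite !sqr_vnorm dot_aut.
Qed.

Lemma aut_orthogonal psi : lie_aut psi ->
  (invmx S *m psi *m S) *m (invmx S *m psi *m S)^T = 1%:M.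
Proof.
case=> _; have [Su ->] := gram_rootP => psiQ.
have -> : (invmx S *m psi *m S) *m (invmx S *m psi *m S)^T =
    invmx S *m (psi *m (S *m S^T) *m psi^T) *m invmx S^T.
  by rewrite !trmx_mul trmx_inv !mulmxA.
by rewrite psiQ !mulmxA mulVmx// mul1mx mulmxV// unitmx_tr.
Qed.

Lemma frob_orthogonalM p (A : 'M[R]_(n, p)) (U : 'M[R]_n) :
  U *m U^T = 1%:M -> frob (U *m A) = frob A.
Proof.
move=> /mulmx1C UU; rewrite !frobE trmx_mul mxtrace_mulC !mulmxA.
by rewrite -(mulmxA _ U^T) UU mulmx1 mxtrace_mulC.
Qed.

Lemma mnorm_autl psi A : lie_aut psi -> mnorm (psi *m A) = mnorm A.
Proof.
move=> psiA; rewrite /mnorm /nrm; congr Num.sqrt.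
rewrite -[RHS](frob_orthogonalM _ (aut_orthogonal psiA)) !mulmxA.
by rewrite (mulmxK gram_root_unit).
Qed.

Lemma mnorm_autr psi A : lie_aut psi -> mnorm (A *m psi) = mnorm A.
Proof.
move=> psiA; rewrite /mnorm -[LHS]nrm_tr -[RHS]nrm_tr /nrm; congr Num.sqrt.
have -> : invmx S *m (A *m psi) *m S =
    (invmx S *m A *m S) *m (invmx S *m psi *m S).
  by rewrite !mulmxA (mulmxK gram_root_unit).
rewrite trmx_mul frob_orthogonalM// trmxK.
exact/mulmx1C/aut_orthogonal.
Qed.

(* [n%:R - \tr psi] is thus an energy that is smooth in [psi] and measures the
   distance to the identity. *)
Lemma sqr_mnorm_sub1 psi : lie_aut psi ->
  mnorm (psi - 1%:M) ^+ 2 = (n%:R - \tr psi) *+ 2.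
Proof.
move=> /aut_orthogonal; rewrite sqr_nrm frobE.
have Su := gram_root_unit.
have -> : \tr psi = \tr (invmx S *m psi *m S).
  by rewrite mxtrace_mulC mulmxA mulmxV// mul1mx.
have -> : invmx S *m (psi - 1%:M) *m S = invmx S *m psi *m S - 1%:M.
  by rewrite mulmxBr mulmxBl mulmx1 mulVmx.
move: (invmx S *m psi *m S) => U UU.
have -> : (U - 1%:M) *m (U - 1%:M)^T = 1%:M - U - (U^T - 1%:M).
  by rewrite linearB /= trmx1 mulmxBl !mulmxBr UU mul1mx !mulmx1.
by rewrite !raddfB /= mxtrace_tr mxtrace1; ring.
Qed.

(** * Derivations and limits of automorphisms *)

Definition derivation A :=
  forall x y, br x y *m A = br (x *m A) y + br x (y *m A).

Lemma derivation_ad z : derivation (ad z).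
Proof. by move=> x y; rewrite !mul_ad brJ. Qed.

Lemma ad_derivation x A : derivation A -> ad (x *m A) = ad x *m A - A *m ad x.
Proof.
move=> dA; apply: mulmx_eqP => v; rewrite mulmxBr !mulmxA !mul_ad dA.
by rewrite addrK.
Qed.

(** [ad (x *m A)] is the commutator of [ad x] and [A], so cyclicity of the trace turns
    [dot (x *m A) y] into minus the trace of [A *m ad (br x y)]. *)
Lemma derivation_tr_eq0 A : derivation A ->
  (forall z, \tr (A *m ad z) = 0) -> A = 0.
Proof.
move=> dA trA; apply: mulmx_eqP => x; rewrite mulmx0; apply: dot_eq0.
suff xA0 y : dot (x *m A) y = 0 by exact: xA0.
rewrite /killing_dot /killing ad_derivation// mulmxBl raddfB /=.
rewrite -!mulmxA mxtrace_mulC -mulmxA -raddfB /= -mulmxBr -ad_br trA.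
by rewrite oppr0.
Qed.

(** Nondegeneracy of the form yields an inner derivation with the same traces against all [ad z];
    the difference vanishes by [derivation_tr_eq0]. *)
Lemma derivation_inner A : derivation A -> exists w, A = ad w.
Proof.
move=> dA.
pose c : 'rV[R]_n := \row_i - \tr (A *m ad (delta_mx 0 i)).
pose w := c *m invmx gram.
have wE z : dot w z = - \tr (A *m ad z).
  rewrite dot_gram /w mulmxKV ?gram_unit// [in RHS](row_sum_delta z) mxE.
  have -> : \tr (A *m ad (\sum_j z 0 j *: delta_mx 0 j)) =
      \sum_j z 0 j * \tr (A *m ad (delta_mx 0 j)).
    elim: (index_enum _) => [|j s IHs].
      have := ad_lin (-1) 0 0; rewrite scaler0 addr0 scaleN1r addNr => ad0.
      by rewrite !big_nil ad0 mulmx0 raddf0.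
    by rewrite !big_cons ad_lin mulmxDr -scalemxAr raddfD /= mxtraceZ IHs.
  by rewrite -sumrN; apply: eq_bigr => j _; rewrite !mxE mulrC mulrN.
exists w; apply/eqP; rewrite -subr_eq0; apply/eqP; apply: derivation_tr_eq0.
  by move=> x y; rewrite !mulmxBr dA derivation_ad brBl brBr opprD addrACA.
move=> z; rewrite mulmxBl raddfB /=; have := wE z.
by rewrite /killing_dot /killing => /oppr_inj ->; rewrite subrr.
Qed.

Lemma mcvg_br (u v : nat -> 'rV[R]_n) x y :
  mcvg u x -> mcvg v y -> mcvg (fun k => br (u k) (v k)) (br x y).
Proof.
move=> ux vy; have brE a b : br a b = b *m ad a by rewrite mul_ad.
rewrite brE (_ : (fun k => _) = fun k => v k *m ad (u k)); last first.
  by apply/funext => k; rewrite brE.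
apply: mcvgM => // i j.
(* Antisymmetry writes each row of [ad a] as the image of [a] under a fixed matrix. *)
have adE a : (ad a) i j = (- (a *m ad (delta_mx 0 i))) 0 j.
  by rewrite mul_ad -brC !mxE.
rewrite adE (_ : (fun k => _) = fun k => (- (u k *m ad (delta_mx 0 i))) 0 j).
  by apply: (mcvg_entry 0 j); apply: mcvgN; apply: mcvgM (mcvg_cst _).
by apply/funext => k; rewrite adE.
Qed.

Lemma mcvg_mnorm_le (u : nat -> 'M[R]_n) (l : 'M[R]_n) (e : nat -> R) :
  e @ ultra_nat --> 0 -> (forall k, mnorm (u k - l) <= e k) -> mcvg u l.
Proof.
move=> e0 ule; have Su := gram_root_unit.
have uE A : A = S *m (invmx S *m A *m S) *m invmx S.
  by rewrite !mulmxA mulmxV// mul1mx mulmxK.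
rewrite (uE l) (_ : u = fun k => S *m (invmx S *m u k *m S) *m invmx S).
  apply: mcvgM (mcvg_cst _); apply: (mcvgM (mcvg_cst _)).
  apply: mcvg_nrm_le e0 _ => k; rewrite -mulmxBl -mulmxBr; exact: ule.
by apply/funext => k; exact: uE.
Qed.

Lemma cvg_harmonic_ultra : (fun k => k.+1%:R^-1 : R) @ ultra_nat --> 0.
Proof. by apply: cvg_ultra; exact: cvg_harmonic. Qed.

(* The limit direction of two sequences of automorphisms violating this is a nonzero
   derivation, hence inner, and is orthogonal to all inner derivations. *)
Lemma lie_aut_separated : exists2 d : R, 0 < d & forall psi phi,
  lie_aut psi -> lie_aut phi -> mnorm (psi - 1%:M) <= d ->
  mnorm (phi - 1%:M) <= d -> (forall z, \tr ((psi - phi) *m ad z) = 0) ->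
  psi = phi.
Proof.
apply: contrapT => /forall2NP H.
have /(_ _)/cid P k : exists p : 'M[R]_n * 'M[R]_n, [/\ lie_aut p.1, lie_aut p.2,
    mnorm (p.1 - 1%:M) <= k.+1%:R^-1, mnorm (p.2 - 1%:M) <= k.+1%:R^-1 &
    (forall z, \tr ((p.1 - p.2) *m ad z) = 0) /\ p.1 <> p.2].
  have [/negP|] := H (k.+1%:R^-1); first by rewrite invr_gt0 ltr0n.
  move=> /existsNP[psi /existsNP[phi]].
  move=> /not_implyP[a1 /not_implyP[a2 /not_implyP[a3 /not_implyP[a4]]]].
  by move=> /not_implyP[a5 a6]; exists (psi, phi); split.
pose p k := (projT1 (P k)).1; pose q k := (projT1 (P k)).2.
have pqP k : [/\ lie_aut (p k), lie_aut (q k),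
    mnorm (p k - 1%:M) <= k.+1%:R^-1, mnorm (q k - 1%:M) <= k.+1%:R^-1 &
    (forall z, \tr ((p k - q k) *m ad z) = 0) /\ p k <> q k].
  exact: (projT2 (P k)).
have p1 : mcvg p 1%:M.
  by apply: mcvg_mnorm_le cvg_harmonic_ultra _ => k; have [] := pqP k.
have q1 : mcvg q 1%:M.
  by apply: mcvg_mnorm_le cvg_harmonic_ultra _ => k; have [] := pqP k.
pose a k := (mnorm (p k - q k))^-1.
pose u k := a k *: (p k - q k).
have pq0 k : 0 < mnorm (p k - q k).
  rewrite lt_def mnorm_ge0 andbT; apply/eqP => /mnorm_eq0/eqP.
  by rewrite subr_eq0 => /eqP; have [_ _ _ _ []] := pqP k.
have u1 k : mnorm (u k) = 1.
  by rewrite mnormZ ger0_norm ?invr_ge0 ?mnorm_ge0// mulVf// gt_eqF.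
have [l ul] : exists l, mcvg u l.
  by apply: (mnorm_bounded (M := 1)) => k; rewrite u1.
have l1 : mnorm l = 1.
  apply: ultra_unique (cvg_mnorm ul) _.
  by under eq_fun do rewrite u1; exact: cvg_cst.
suff l0 : l = 0 by move/eqP: l1; rewrite l0 mnorm0 eq_sym oner_eq0.
apply: derivation_tr_eq0 => [x y|z].
  apply: mcvg_unique (mcvgM (mcvg_cst (br x y)) ul) _.
  (* A difference of two homomorphisms satisfies a Leibniz rule twisted by both of them; the twists
     [p k] and [q k] tend to the identity. *)
  rewrite (_ : (fun k => _) = fun k => br (x *m u k) (y *m p k) +
    br (x *m q k) (y *m u k)); last first.
    apply/funext => k; have [[hp _] [hq _] _ _ _] := pqP k.
    rewrite /u -!scalemxAr brZl brZr -scalerDr; congr (_ *: _).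
    by rewrite !mulmxBr -hp -hq brBl brBr addrA subrK.
  have := mcvgD (mcvg_br (mcvgM (mcvg_cst x) ul) (mcvgM (mcvg_cst y) p1))
                (mcvg_br (mcvgM (mcvg_cst x) q1) (mcvgM (mcvg_cst y) ul)).
  by rewrite !mulmx1.
apply: ultra_unique (cvg_mxtrace (mcvgM ul (mcvg_cst (ad z)))) _.
rewrite (_ : (fun k => _) = fun=> 0); first exact: cvg_cst.
apply/funext => k; have [_ _ _ _ [tr0 _]] := pqP k.
by rewrite -scalemxAl mxtraceZ tr0 mulr0.
Qed.

Lemma lie_aut_lim (u : nat -> 'M[R]_n) psi :
  mcvg u psi -> (forall k, lie_aut (u k)) -> lie_aut psi.
Proof.
move=> ul ua; split=> [x y|].
  apply: mcvg_unique (mcvgM (mcvg_cst (br x y)) ul).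
  have := mcvg_br (mcvgM (mcvg_cst x) ul) (mcvgM (mcvg_cst y) ul).
  by rewrite (_ : (fun k => br _ _) = fun k => br x y *m u k)//; apply/funext => k;
    rewrite (proj1 (ua k)).
have := mcvgM (mcvgM ul (mcvg_cst gram)) (mcvg_tr ul).
rewrite (_ : (fun k => _) = fun=> gram) => [|].
  by move/mcvg_unique; apply; exact: mcvg_cst.
by apply/funext => k; rewrite (proj2 (ua k)).
Qed.

Lemma lie_aut_mnorm psi : lie_aut psi -> mnorm psi = mnorm 1%:M.
Proof. by move=> psiA; rewrite -[psi]mulmx1 mnorm_autl. Qed.

Lemma lie_aut_compact (u : nat -> 'M[R]_n) : (forall k, lie_aut (u k)) ->
  exists2 l, lie_aut l & mcvg u l.
Proof.
move=> ua; have [k|l ul] := @mnorm_bounded u (mnorm 1%:M).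
  by rewrite lie_aut_mnorm.
by exists l => //; apply: lie_aut_lim ul ua.
Qed.

(** * Factorisations into automorphisms and their energy *)

Definition prodm (s : seq 'M[R]_n) : 'M[R]_n := foldr mulmx 1%:M s.

Definition defect (s : seq 'M[R]_n) : R := \sum_(psi <- s) (n%:R - \tr psi).

Definition auts (s : seq 'M[R]_n) : Prop := forall psi, psi \in s -> lie_aut psi.

Lemma auts_cons psi s : auts (psi :: s) <-> lie_aut psi /\ auts s.
Proof.
split=> [as_|[ap as_] phi]; last by rewrite inE => /orP[/eqP->|/as_].
by split=> [|phi ps]; apply: as_; rewrite inE ?eqxx// ps orbT.
Qed.

Lemma auts_cat s t : auts (s ++ t) <-> auts s /\ auts t.
Proof.
split=> [ast|[as_ at_] phi]; last by rewrite mem_cat => /orP[/as_|/at_].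
by split=> psi ps; apply: ast; rewrite mem_cat ps ?orbT.
Qed.

Lemma prodm_cat s t : prodm (s ++ t) = prodm s *m prodm t.
Proof. by elim: s => [|a s IHs] /=; rewrite ?mul1mx// IHs mulmxA. Qed.

Lemma prodm_nseq k psi : prodm (nseq k psi) = psi ^+ k.
Proof. by elim: k => [|k IHk]; rewrite ?expr0//= IHk exprS. Qed.

Lemma defect_ge0 s : auts s -> 0 <= defect s.
Proof.
move=> as_; rewrite /defect big_seq; apply: sumr_ge0 => psi /as_/sqr_mnorm_sub1 E.
by rewrite -(pmulrn_lge0 _ (ltn0Sn 1)) -E sqr_ge0.
Qed.

(** All entries of the lists converge along the same ultrafilter, so induction on the length needs
    no extraction of subsequences. *)
Lemma auts_compact N (s : nat -> seq 'M[R]_n) :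
  (forall k, size (s k) = N /\ auts (s k)) ->
  exists t, [/\ size t = N, auts t, mcvg (fun k => prodm (s k)) (prodm t) &
    (fun k => defect (s k)) @ ultra_nat --> defect t].
Proof.
elim: N s => [|N IHN] s sN.
  have -> : s = fun=> [::].
    by apply/funext => k; have [/size0nil] := sN k.
  by exists [::]; split=> //; [exact: mcvg_cst|exact: cvg_cst].
pose h k := head 1%:M (s k); pose b k := behead (s k).
have sE k : s k = h k :: b k.
  by rewrite /h /b; have [] := sN k; case: (s k).
have hb k : lie_aut (h k) /\ size (b k) = N /\ auts (b k).
  have [] := sN k; rewrite sE => -[bN] /auts_cons[ha ba].
  by split.
have [t [tN ta tp td]] := IHN b (fun k => proj2 (hb k)).
have [l la hl] := lie_aut_compact (fun k => proj1 (hb k)).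
exists (l :: t); split.
- by rewrite /= tN.
- by apply/auts_cons.
- by under eq_fun do rewrite sE; exact: mcvgM hl tp.
- under eq_fun do rewrite sE /defect big_cons; rewrite /defect big_cons.
  by apply: cvgD td; apply: cvgB; [exact: cvg_cst|exact: cvg_mxtrace].
Qed.

Lemma exists_min_defect N phi :
  (exists2 s, size s = N /\ auts s & prodm s = phi) ->
  exists s, [/\ size s = N, auts s, prodm s = phi & forall t, size t = N ->
    auts t -> prodm t = phi -> defect s <= defect t].
Proof.
move=> [s0 [s0N s0a] s0p].
pose E := [set defect s | s in [set s | [/\ size s = N, auts s & prodm s = phi]]].
have infE : has_inf E.
  split; first by exists (defect s0), s0.
  by exists 0 => _ [s [_ sa _] <-]; exact: defect_ge0.
have /(_ _)/cid P k : exists s, [/\ size s = N, auts s, prodm s = phi &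
    defect s <= inf E + k.+1%:R^-1].
  have k0 : (0 : R) < k.+1%:R^-1 by rewrite invr_gt0.
  have [_ [s [sN sa sp] <-] sE] := inf_adherent k0 infE.
  by exists s; split=> //; exact: ltW.
pose s k := projT1 (P k).
have sP k : [/\ size (s k) = N, auts (s k), prodm (s k) = phi &
    defect (s k) <= inf E + k.+1%:R^-1] by exact: (projT2 (P k)).
have [|t [tN ta tp td]] := @auts_compact N s.
  by move=> k; have [] := sP k.
have tphi : prodm t = phi.
  apply: mcvg_unique tp _.
  rewrite (_ : (fun k => _) = fun=> phi); first exact: mcvg_cst.
  by apply/funext => k; have [] := sP k.
exists t; split=> // r rN ra rp.
apply: (@le_trans _ _ (inf E)); last first.
  by apply: ge_inf; [case: infE|exists r].
have inv0 : (fun k => inf E + k.+1%:R^-1) @ ultra_nat --> inf E.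
  rewrite -[X in _ --> X]addr0.
  by apply: cvgD; [exact: cvg_cst|exact: cvg_harmonic_ultra].
by apply: ultra_le td inv0 _; apply: nearW => k; have [] := sP k.
Qed.

Lemma form_eqP A B :
  (forall x y, (x *m A *m y^T) 0 0 = (x *m B *m y^T) 0 0) -> A = B.
Proof.
have E (M : 'M[R]_n) (i j : 'I_n) :
    ((delta_mx 0 i : 'rV[R]_n) *m M *m (delta_mx 0 j : 'rV[R]_n)^T) 0 0 = M i j.
  by rewrite trmx_delta -rowE -colE !mxE.
by move=> AB; apply/matrixP => i j; rewrite -E AB E.
Qed.

Lemma lie_inv_ad z : gram *m (ad z)^T *m invmx gram = - ad z.
Proof.
have -> : gram *m (ad z)^T = - (ad z *m gram).
  apply: form_eqP => x y; have := dot_br x y z; rewrite !dot_gram -!mul_ad.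
  move=> h; rewrite mulmxN mulNmx !mulmxA [RHS]mxE h opprK trmx_mul.
  by rewrite !mulmxA.
by rewrite mulNmx mulmxK// gram_unit.
Qed.

(* A substitute for the one-parameter groups [exp (t ad z)], which avoids the
   exponential and is what the adjoint representation provides directly. *)
Hypothesis infinitesimal_aut : forall z, exists chi : nat -> 'M[R]_n,
  [/\ forall k, lie_aut (chi k),
      exists C, forall k, mnorm (2 ^+ k *: (chi k - 1%:M)) <= C &
      mcvg (fun k => 2 ^+ k *: (chi k - 1%:M)) (ad z)].

(** First variation of the energy of two neighbouring factors when [chi] is moved from one to the
    other. Along [ad z] the derivative of the left side is the trace of [(a - b) *m ad z]; it is at
    most 0 for both [z] and [- z]. *)
Lemma tr_variation a b :
  (forall chi, lie_aut chi -> \tr (a *m chi) + \tr (lie_inv chi *m b) <=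
    \tr a + \tr b) -> forall z, \tr ((a - b) *m ad z) = 0.
Proof.
move=> H; have le0 z : \tr ((a - b) *m ad z) <= 0.
  have [chi [chia _ chi_ad]] := infinitesimal_aut z.
  pose w k := 2 ^+ k *: (chi k - 1%:M).
  have lim := cvgD (cvg_mxtrace (mcvgM (mcvg_cst a) chi_ad))
    (cvg_mxtrace (mcvgM (mcvgM (mcvgM (mcvg_cst gram) (mcvg_tr chi_ad))
      (mcvg_cst (invmx gram))) (mcvg_cst b))).
  have := ultra_le_cst (lim _); rewrite lie_inv_ad mulNmx raddfN /=.
  rewrite mulmxBl raddfB /= (mxtrace_mulC b); apply=> k; rewrite fctE.
  have := H _ (chia k).
  have invE : gram *m (2 ^+ k *: (chi k - 1%:M))^T *m invmx gram =
      2 ^+ k *: (lie_inv (chi k) - 1%:M).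
    rewrite linearZ /= -scalemxAr -scalemxAl linearB /= trmx1 mulmxBr mulmxBl.
    by rewrite mulmx1 mulmxV// gram_unit.
  rewrite invE -scalemxAr -scalemxAl !mxtraceZ -mulrDr mulmxBr mulmx1 mulmxBl.
  rewrite mul1mx !raddfB /= => h; rewrite pmulr_rle0 ?exprn_gt0//; lra.
move=> z; apply/eqP; rewrite eq_le le0 /=.
have := le0 (- z); rewrite (_ : ad (- z) = - ad z); last first.
  by apply: mulmx_eqP => v; rewrite mulmxN !mul_ad brNl.
by rewrite mulmxN raddfN /= oppr_le0.
Qed.

Lemma seq_const (s : seq 'M[R]_n) :
  (forall s1 a b s2, s = s1 ++ a :: b :: s2 -> a = b) ->
  s = nseq (size s) (head 1%:M s).
Proof.
elim: s => [//|a [//|b s] IHs] H.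
have ab : a = b by apply: (H [::]).
rewrite [LHS](congr1 (cons a) (IHs _)) /= ?ab//.
by move=> s1 c d s2 E; apply: (H (a :: s1) c d s2); rewrite E.
Qed.

(* [phi] is at finite distance from the identity, along a chain of automorphisms. *)
Definition reach phi : Prop := exists (C : R) m, forall i, exists s,
  [/\ size s = (m * 2 ^ i)%N, auts s,
      forall psi, psi \in s -> mnorm (psi - 1%:M) <= C / 2 ^+ i &
      prodm s = phi].

Lemma defect_mnorm s : auts s ->
  defect s *+ 2 = \sum_(psi <- s) mnorm (psi - 1%:M) ^+ 2.
Proof.
move=> as_; rewrite /defect -sumrMnl big_seq [RHS]big_seq.
by apply: eq_bigr => psi /as_/sqr_mnorm_sub1.
Qed.

Lemma defect_le s c : auts s ->
  (forall psi, psi \in s -> mnorm (psi - 1%:M) <= c) ->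
  defect s *+ 2 <= (size s)%:R * c ^+ 2.
Proof.
move=> as_ sc; rewrite defect_mnorm//; elim: s sc {as_} => [|a s IHs] sc.
  by rewrite big_nil mul0r.
rewrite big_cons /= -[(size s).+1]add1n natrD mulrDl mul1r lerD//.
  have := sc a (mem_head _ _); have := mnorm_ge0 (a - 1%:M); nra.
by apply: IHs => psi ps; apply: sc; rewrite inE ps orbT.
Qed.

Lemma mnorm_le_defect s psi : auts s -> psi \in s ->
  mnorm (psi - 1%:M) ^+ 2 <= defect s *+ 2.
Proof.
move=> as_ ps; rewrite defect_mnorm// (big_rem psi)//= lerDl.
by apply: sumr_ge0 => phi _; exact: sqr_ge0.
Qed.

(* Equidistribution of a discrete geodesic: a factorisation of [phi] into small
   automorphisms that minimises the energy has all its factors equal. *)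
Lemma reach_root phi : reach phi -> exists C m i0, forall i, (i0 <= i)%N ->
  exists psi, [/\ lie_aut psi, psi ^+ (m * 2 ^ i) = phi &
    mnorm (psi - 1%:M) <= C / 2 ^+ i].
Proof.
move=> [C0 [m H]]; have [d d0 sep] := lie_aut_separated.
pose C : R := `|C0|; exists C, m.
have C_ge0 : 0 <= C by exact: normr_ge0.
(* From [i0] on, the total energy [m%:R * C ^+ 2 / 2 ^+ i] is at most [d ^+ 2], which puts every
   factor of the minimiser in the ball where [lie_aut_separated] applies. *)
pose i0 := Num.bound (m%:R * C ^+ 2 / d ^+ 2 : R); exists i0 => i ii0.
have p2 k : (0 : R) < 2 ^+ k by rewrite exprn_gt0.
have c0 : 0 <= C / 2 ^+ i by rewrite divr_ge0 ?normr_ge0// ltW.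
have [s [sN sa sC sp]] := H i.
have [|t [tN ta tp tmin]] := @exists_min_defect (m * 2 ^ i) phi; first by exists s.
have tdef : defect t *+ 2 <= (m * 2 ^ i)%:R * (C / 2 ^+ i) ^+ 2.
  apply: (@le_trans _ _ (defect s *+ 2)); first by rewrite lerMn2r tmin.
  rewrite -sN; apply: defect_le => // psi /sC /le_trans; apply.
  by rewrite ler_wpM2r ?invr_ge0 ?ler_norm// ltW.
have md : (m * 2 ^ i)%:R * (C / 2 ^+ i) ^+ 2 <= d ^+ 2.
  rewrite natrM natrX expr_div_n.
  have -> : m%:R * 2 ^+ i * (C ^+ 2 / 2 ^+ i ^+ 2) = m%:R * C ^+ 2 / 2 ^+ i :> R.
    by field; rewrite gt_eqF.
  rewrite ler_pdivrMr// [leRHS]mulrC -ler_pdivrMr ?exprn_gt0//.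
  apply: (@le_trans _ _ i0%:R).
    apply/ltW/archi_boundP; by rewrite divr_ge0 ?mulr_ge0 ?(ltW d0).
  by rewrite -natrX ler_nat (leq_trans ii0)// ltnW// ltn_expl.
have tsmall psi : psi \in t -> mnorm (psi - 1%:M) <= d.
  move=> pt; rewrite -(@ler_pXn2r _ 2)// ?nnegrE ?mnorm_ge0 ?(ltW d0)//.
  by apply: le_trans (mnorm_le_defect ta pt) _; apply: le_trans md.
have tE : t = nseq (size t) (head 1%:M t).
  apply: seq_const => s1 a b s2 tE.
  have [s1a aa ba s2a] : [/\ auts s1, lie_aut a, lie_aut b & auts s2].
    by move: ta; rewrite tE => /auts_cat[? /auts_cons[? /auts_cons[? ?]]].
  apply: sep => //.
  - by apply: tsmall; rewrite tE mem_cat !inE eqxx orbT.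
  - by apply: tsmall; rewrite tE mem_cat !inE eqxx !orbT.
  - apply: tr_variation => chi ca.
    (* The competitor has the same product, and only two terms of its energy change. *)
    have := tmin (s1 ++ a *m chi :: lie_inv chi *m b :: s2).
    rewrite -tN tE !size_cat /= => /(_ erefl).
    have h : auts (s1 ++ a *m chi :: lie_inv chi *m b :: s2).
      apply/auts_cat; split=> //; apply/auts_cons; split; first exact: lie_autM.
      by apply/auts_cons; split=> //; apply: lie_autM => //; exact: lie_autV.
    move=> /(_ h); have hE : prodm (s1 ++ a *m chi :: lie_inv chi *m b :: s2) = phi.
      rewrite -tp tE !prodm_cat /=; congr (_ *m _).
      move: (lie_inv chi) (mul_lie_inv ca) => ci cK.
      by rewrite -!mulmxA (mulmxA chi) cK mul1mx.
    move=> /(_ hE); rewrite /defect !big_cat !big_cons /=; lra.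
exists (head 1%:M t); split.
- move: ta; case: (t) => [_|a u /auts_cons[]//]; exact: lie_aut1.
- by rewrite -tN -prodm_nseq -tE.
(* All terms of the energy being equal, its bound divided by the length bounds each of them. *)
- have [t0|t0] := posnP (size t).
    by rewrite (size0nil t0) /= subrr mnorm0.
  have hs : (0 : R) < (size t)%:R by rewrite ltr0n.
  rewrite -(@ler_pXn2r _ 2)// ?nnegrE ?mnorm_ge0// -(ler_pM2l hs).
  rewrite [X in _ <= X%:R * _]tN; apply: le_trans tdef.
  rewrite defect_mnorm// [X in _ <= \sum_(_ <- X) _]tE.
  move: (head _ _) (size t) => a k {hs t0 tE}.
  elim: k => [|k IHk]; first by rewrite big_nil mul0r.
  by rewrite /= big_cons -[k.+1]add1n natrD mulrDl mul1r lerD2l.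
Qed.

Lemma vnorm_iter psi x k : lie_aut psi ->
  vnorm (x *m psi ^+ k - x) <= k%:R * vnorm (x *m psi - x).
Proof.
move=> psiA; elim: k => [|k IHk].
  by rewrite expr0 mulmx1 subrr vnorm0 mul0r.
rewrite exprSr -mulmxE mulmxA.
have -> : x *m psi ^+ k *m psi - x =
    (x *m psi ^+ k - x) *m psi + (x *m psi - x).
  by rewrite mulmxBl addrA subrK.
apply: le_trans (vnormD _ _) _; rewrite vnorm_aut// -[k.+1]addn1 natrD.
by rewrite mulrDl mul1r lerD2r.
Qed.

(** Along the roots [psi i] the rescaled differences [D i] subconverge to a derivation [ad y]. An
    isometry iterated [k] times displaces [x] at most [k] times as much as once, so the displacement
    of [x] by [phi] is at most the limit of [m%:R * vnorm (x *m D i)], which is zero when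
    [br y x = 0]. *)
Lemma reach_fix phi : reach phi ->
  exists y, forall x, br y x = 0 -> x *m phi = x.
Proof.
move=> /reach_root[C [m [i0 H]]].
have /(_ _)/cid P i := H (i + i0)%N (leq_addl _ _).
pose psi i := projT1 (P i).
have psiP i : [/\ lie_aut (psi i), psi i ^+ (m * 2 ^ (i + i0)) = phi &
    mnorm (psi i - 1%:M) <= C / 2 ^+ (i + i0)] by exact: (projT2 (P i)).
have p2 k : (0 : R) < 2 ^+ k by rewrite exprn_gt0.
pose D i := 2 ^+ (i + i0) *: (psi i - 1%:M).
have DC i : mnorm (D i) <= C.
  rewrite mnormZ ger0_norm ?(ltW (p2 _))// mulrC -ler_pdivlMr//.
  by have [] := psiP i.
have [l Dl] := mnorm_bounded DC.
have geo : (fun i => C / 2 ^+ (i + i0)) @ ultra_nat --> (0 : R).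
  rewrite -(mulr0 C); apply: cvgM; first exact: cvg_cst.
  apply: cvg_ultra.
  rewrite (_ : (fun i => _) = (fun k => 2^-1 ^+ k) \o (fun i => (i + i0)%N)); last first.
    by apply/funext => i /=; rewrite exprVn.
  have e2 : (fun k => (2^-1 : R) ^+ k) @ \oo --> (0 : R).
    by apply: cvg_expr; rewrite ger0_norm// invf_lt1// ltr1n.
  by move: e2; rewrite -(cvg_shiftn i0).
have psi1 : mcvg psi 1%:M.
  by apply: mcvg_mnorm_le geo _ => i; have [] := psiP i.
have dl : derivation l.
  move=> x y; apply: mcvg_unique (mcvgM (mcvg_cst (br x y)) Dl) _.
  rewrite (_ : (fun k => _) = fun k => br (x *m D k) (y *m psi k) +
    br x (y *m D k)); last first.
    apply/funext => k; have [[hp _] _ _] := psiP k.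
    rewrite /D -!scalemxAr brZl brZr -scalerDr; congr (_ *: _).
    by rewrite !mulmxBr !mulmx1 -hp brBl brBr addrA subrK.
  have := mcvgD (mcvg_br (mcvgM (mcvg_cst x) Dl) (mcvgM (mcvg_cst y) psi1))
                (mcvg_br (mcvg_cst x) (mcvgM (mcvg_cst y) Dl)).
  by rewrite mulmx1.
have [y ly] := derivation_inner dl; exists y => x yx0.
apply/eqP; rewrite -subr_eq0; apply/eqP/vnorm_eq0.
apply/eqP; rewrite eq_le nrm_ge0 andbT.
have lim : (fun i => m%:R * vnorm (x *m D i)) @ ultra_nat --> (0 : R).
  rewrite -[X in _ --> X](mulr0 m%:R); apply: cvgM; first exact: cvg_cst.
  rewrite -(nrm0 R 1 n) -(mul0mx _ S) -yx0 -mul_ad -ly.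
  by apply: nrm_mcvg; apply: mcvgM (mcvg_cst S); apply: mcvgM Dl; exact: mcvg_cst.
apply: (ultra_ge_cst lim) => i; have [pa pE _] := psiP i.
rewrite -pE (le_trans (vnorm_iter _ _ pa))// natrM natrX -mulrA ler_wpM2l//.
by rewrite /D -scalemxAr vnormZ ger0_norm ?(ltW (p2 _))// mulmxBr mulmx1.
Qed.

(** * Exponentials of inner derivations *)

Lemma mcvgX (u : nat -> 'M[R]_n) (l : 'M[R]_n) k :
  mcvg u l -> mcvg (fun j => u j ^+ k) (l ^+ k).
Proof.
move=> ul; elim: k => [|k IHk].
  by rewrite expr0; under eq_fun do rewrite expr0; exact: mcvg_cst.
by rewrite exprS; under eq_fun do rewrite exprS; exact: mcvgM ul IHk.
Qed.

Lemma mnorm_iter psi k : lie_aut psi ->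
  mnorm (psi ^+ k - 1%:M) <= k%:R * mnorm (psi - 1%:M).
Proof.
move=> psiA; elim: k => [|k IHk]; first by rewrite expr0 subrr mnorm0 mul0r.
have -> : psi ^+ k.+1 - 1%:M = (psi ^+ k - 1%:M) *m psi + (psi - 1%:M).
  by rewrite exprSr mulmxBl mul1mx addrA subrK.
apply: le_trans (mnormD _ _) _; rewrite mnorm_autr// -[k.+1]addn1 natrD.
by rewrite mulrDl mul1r lerD2r.
Qed.

(** On the plane of [t] and [w] the operator [cos h + sin h A] is a rotation by the angle [h]. Each
    step adds one error of comparing [psi] with it, and the isometry [psi] does not amplify the
    earlier errors. *)
Lemma vnorm_rotate psi (t w : 'rV[R]_n) A (h : R) k : lie_aut psi ->
  t *m A = - w -> w *m A = t ->
  vnorm (t *m psi ^+ k - (cos (h *+ k) *: t - sin (h *+ k) *: w)) <=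
  k%:R * ((vnorm t + vnorm w) * mnorm (psi - (cos h)%:M - sin h *: A)).
Proof.
move=> psiA tA wA; set E := psi - _ - _.
pose g (x : R) : 'rV[R]_n := cos x *: t - sin x *: w.
rewrite -/(g (h *+ k)).
elim: k => [|k IHk].
  by rewrite expr0 mulmx1 mulr0n /g cos0 sin0 scale1r scale0r subr0 subrr vnorm0 mul0r.
have -> : t *m psi ^+ k.+1 - g (h *+ k.+1) =
    (t *m psi ^+ k - g (h *+ k)) *m psi + g (h *+ k) *m E.
  rewrite exprSr mulmxBl -mulmxA mulmxE -addrA; congr (_ + _).
  have -> : g (h *+ k.+1) = cos h *: g (h *+ k) + sin h *: (g (h *+ k) *m A).
    rewrite /g mulrSr cosD sinD mulmxBl -!scalemxAl tA wA.
    by apply/rowP => i; rewrite !mxE; ring.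
  rewrite /E !mulmxBr mul_mx_scalar -scalemxAr; move: (g _) => G.
  by rewrite !addrA addNr add0r opprD.
apply: le_trans (vnormD _ _) _; rewrite vnorm_aut// -[k.+1]addn1 natrD.
rewrite mulrDl mul1r lerD// (le_trans (vnormM _ _))// ler_wpM2r ?mnorm_ge0//.
apply: le_trans (vnormD _ _) _; rewrite -scaleNr !vnormZ normrN.
rewrite lerD// ler_piMl ?nrm_ge0//.
  by rewrite ler_norml cos_geN1 cos_le1.
by rewrite ler_norml sin_geN1 sin_le1.
Qed.

(** [phi] is the limit of [chi k ^+ (2 ^ k)] and plays the role of exp (ad u). The last clause is a
    half turn, [u] acting on the plane of [t] and [w] with angular speed [pi]. *)
Lemma exp_aut u : exists phi, [/\ lie_aut phi, reach phi,
  forall x, br u x = 0 -> x *m phi = x &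
  forall t w, br u t = - pi *: w -> br u w = pi *: t -> t *m phi = - t].
Proof.
have [chi [chia [C chiC] chi_ad]] := infinitesimal_aut u.
have p2 k : (0 : R) < 2 ^+ k by rewrite exprn_gt0.
have chiX k : lie_aut (chi k ^+ (2 ^ k)) by exact: lie_autX.
have [phi phia phil] := lie_aut_compact chiX.
exists phi; split=> //.
- exists C, 1%N => i.
  (* The analogue of exp (2^-i ad u). The truncated difference [k - i] is a true one as soon as
     [i <= k], and the limit sees only such [k]. *)
  have [psi psia psil] := lie_aut_compact (fun k => lie_autX (2 ^ (k - i)) (chia k)).
  exists (nseq (2 ^ i) psi); split.
  + by rewrite size_nseq mul1n.
  + by move=> x /nseqP[->].
  + move=> x /nseqP[-> _].
    apply: ultra_le (cvg_mnorm (mcvgB psil (mcvg_cst 1%:M))) (cvg_cst _) _.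
    near=> k; have ik : (i <= k)%N by near: k; exact: nbhs_infty_ge.
    apply: le_trans (mnorm_iter _ (chia k)) _.
    have := chiC k; rewrite mnormZ ger0_norm ?(ltW (p2 _))// => chiCk.
    rewrite natrX -(@ler_pM2l _ (2 ^+ i))// mulrA -exprD subnKC//.
    by rewrite mulrCA mulfV ?mulr1// gt_eqF.
  + rewrite prodm_nseq; apply: mcvg_unique (mcvgX (k := 2 ^ i) psil) _.
    apply: mcvg_near phil; near=> k.
    have ik : (i <= k)%N by near: k; exact: nbhs_infty_ge.
    by rewrite -exprM -expnD subnK.
- move=> x ux0; apply/eqP; rewrite -subr_eq0; apply/eqP/vnorm_eq0.
  apply/eqP; rewrite eq_le nrm_ge0 andbT.
  have lim : (fun k => vnorm (x *m (2 ^+ k *: (chi k - 1%:M)))) @ ultra_nat --> (0 : R).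
    rewrite -(nrm0 R 1 n) -(mul0mx _ S) -ux0 -mul_ad.
    apply: nrm_mcvg; apply: mcvgM (mcvg_cst S).
    exact: mcvgM (mcvg_cst x) chi_ad.
  have lim2 := nrm_mcvg (mcvgM (mcvgB (mcvgM (mcvg_cst x) phil) (mcvg_cst x))
    (mcvg_cst S)).
  apply: ultra_le lim2 lim _; apply: nearW => k.
  apply: le_trans (vnorm_iter _ _ (chia k)) _.
  by rewrite -scalemxAr vnormZ ger0_norm ?(ltW (p2 _))// mulmxBr mulmx1 natrX.
- move=> t w ut uw; apply/eqP; rewrite -subr_eq0; apply/eqP/vnorm_eq0.
  have pi0 : (pi : R) != 0 by rewrite gt_eqF// pi_gt0.
  pose A := pi^-1 *: ad u.
  have tA : t *m A = - w by rewrite -scalemxAr mul_ad ut scalerA mulrN mulVf// scaleN1r.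
  have wA : w *m A = t by rewrite -scalemxAr mul_ad uw scalerA mulVf// scale1r.
  apply/eqP; rewrite eq_le nrm_ge0 andbT.
  pose h k : R := pi / 2 ^+ k.
  (* The accumulated error of [2 ^ k] steps of angle [pi / 2 ^+ k]; at first order [chi k] and the
     rotation agree because [ad u = pi *: A]. *)
  pose E k := 2 ^+ k *: (chi k - (cos (h k))%:M - sin (h k) *: A).
  have E0 : mcvg E 0.
    have cl : (fun k => 2 ^+ k * (cos (h k) - 1)) @ ultra_nat --> (0 : R).
      apply: cvg_ultra; have := cvg_pow2_derive (is_derive_cos (0 : R)) pi0.
      by rewrite sin0 oppr0 scaler0 cos0.
    have sl : (fun k => 2 ^+ k * sin (h k)) @ ultra_nat --> (pi : R).
      apply: cvg_ultra; have := cvg_pow2_derive (is_derive_sin (0 : R)) pi0.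
      rewrite cos0 -[pi *: 1]/(pi * 1) mulr1 sin0.
      by under eq_fun do rewrite subr0.
    have := mcvgB (mcvgB chi_ad (mcvgZ cl (mcvg_cst 1%:M))) (mcvgZ sl (mcvg_cst A)).
    rewrite scale0r subr0 /A scalerA mulfV// scale1r subrr.
    apply: mcvg_near; apply: nearW => k.
    rewrite /E -scalerA -!scalerA -!scalerBr; congr (_ *: (_ - _)).
    by rewrite scalerBl scale1r scalemx1 opprB addrA subrK.
  have lim : (fun k => (vnorm t + vnorm w) * mnorm (E k)) @ ultra_nat --> (0 : R).
    rewrite -(mulr0 (vnorm t + vnorm w)); apply: cvgM; first exact: cvg_cst.
    by rewrite -mnorm0; exact: cvg_mnorm.
  have lim2 := nrm_mcvg (mcvgM (mcvgB (mcvgM (mcvg_cst t) phil) (mcvg_cst (- t)))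
    (mcvg_cst S)).
  apply: ultra_le lim2 lim _; apply: nearW => k.
  have := vnorm_rotate (h k) (2 ^ k) (chia k) tA wA.
  have -> : h k *+ (2 ^ k) = pi.
    by rewrite -mulr_natr natrX /h mulfVK// gt_eqF.
  rewrite cospi sinpi scaleN1r scale0r subr0 => /le_trans; apply.
  by rewrite /E mnormZ ger0_norm ?(ltW (p2 _))// natrX mulrCA.
Unshelve. all: by end_near. Qed.

(** * Eigenvectors of symmetric operators *)

Lemma cvg_dot (u v : nat -> 'rV[R]_n) x y : mcvg u x -> mcvg v y ->
  (fun k => dot (u k) (v k)) @ ultra_nat --> dot x y.
Proof.
move=> ux vy; rewrite dot_gram.
rewrite (_ : (fun k => _) = fun k => (u k *m gram *m (v k)^T) 0 0); last first.
  by apply/funext => k; rewrite dot_gram.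
exact: (mcvg_entry 0 0 (mcvgM (mcvgM ux (mcvg_cst gram)) (mcvg_tr vy))).
Qed.

Lemma memv_lim (V : {vspace 'rV[R]_n}) (u : nat -> 'rV[R]_n) x :
  mcvg u x -> (forall k, u k \in V) -> x \in V.
Proof.
move=> ux uV; suff <- : projv V x = x by exact: memv_proj.
rewrite -(mul_rV_lin1 (projv V)); apply: mcvg_unique (mcvgM ux (mcvg_cst _)) _.
by move: ux; apply: mcvg_near; apply: nearW => k; rewrite mul_rV_lin1 /= projv_id.
Qed.

Lemma dot_le x y : dot x y <= vnorm x * vnorm y.
Proof.
have := @discr_le R (dot x x) (dot x y) (dot y y) (dot_ge0 y).
rewrite -!sqr_vnorm -exprMn => H; apply: le_trans (ler_norm _) _.
rewrite -(@ler_pXn2r _ 2)// ?nnegrE ?mulr_ge0 ?nrm_ge0// real_normK ?num_real//.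
apply: H => t; rewrite !sqr_vnorm.
suff -> : dot x x + t * dot x y *+ 2 + t ^+ 2 * dot y y =
   dot (x + t *: y) (x + t *: y) by exact: dot_ge0.
by rewrite !dotDl !dotDr !dotZl !dotZr (dotC y x); ring.
Qed.

(* Maximising the Rayleigh quotient. *)
Lemma symmetric_eigenvector (V : {vspace 'rV[R]_n}) A : V != 0%VS ->
  (forall x, x \in V -> x *m A \in V) ->
  (forall x y, dot (x *m A) y = dot x (y *m A)) ->
  exists x a, [/\ x \in V, x != 0 & x *m A = a *: x].
Proof.
move=> V0 VA Asym.
pose E := [set dot (x *m A) x | x in [set x | x \in V /\ dot x x = 1]].
have normalize v : v \in V -> v != 0 -> exists2 c : R, c != 0 &
    (c *: v \in V) /\ dot (c *: v) (c *: v) = 1.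
  move=> vV v0; have v1 : vnorm v != 0.
    by apply: contra_neq v0; exact: vnorm_eq0.
  exists (vnorm v)^-1; first by rewrite invr_eq0.
  split; first exact: memvZ.
  by rewrite -sqr_vnorm vnormZ ger0_norm ?invr_ge0 ?nrm_ge0// mulVf// expr1n.
have supE : has_sup E.
  split.
    have v0 : vpick V != 0 by rewrite vpick0.
    have [c _ [cV c1]] := normalize _ (memv_pick V) v0.
    by exists (dot ((c *: vpick V) *m A) (c *: vpick V)), (c *: vpick V).
  exists (mnorm A) => _ [x [_ x1] <-]; apply: le_trans (dot_le _ _) _.
  have -> : vnorm x = 1.
    by rewrite -[LHS]ger0_norm ?nrm_ge0// -sqrtr_sqr sqr_vnorm x1 sqrtr1.
  rewrite mulr1; apply: le_trans (vnormM _ _) _.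
  have -> : vnorm x = 1.
    by rewrite -[LHS]ger0_norm ?nrm_ge0// -sqrtr_sqr sqr_vnorm x1 sqrtr1.
  by rewrite mul1r.
pose a := sup E.
have /(_ _)/cid P k : exists x, [/\ x \in V, dot x x = 1 &
    a - k.+1%:R^-1 <= dot (x *m A) x].
  have k0 : (0 : R) < k.+1%:R^-1 by rewrite invr_gt0.
  have [_ [x [xV x1] <-] xE] := sup_adherent k0 supE.
  by exists x; split=> //; exact: ltW.
pose u k := projT1 (P k).
have uP k : [/\ u k \in V, dot (u k) (u k) = 1 &
    a - k.+1%:R^-1 <= dot (u k *m A) (u k)] by exact: (projT2 (P k)).
have [l ul] : exists l, mcvg u l.
  apply: (nrm_bounded_mcvg (M := nrm (invmx S))) => k.
  rewrite -(mulmxK gram_root_unit (u k)) (le_trans (nrmM _ _))//.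
  rewrite ler_piMl ?nrm_ge0// -[leLHS]ger0_norm ?nrm_ge0// -sqrtr_sqr.
  by rewrite -/(vnorm _) sqr_vnorm; have [_ -> _] := uP k; rewrite sqrtr1.
have lV : l \in V by apply: memv_lim ul _ => k; have [] := uP k.
have l1 : dot l l = 1.
  apply: ultra_unique (cvg_dot ul ul) _.
  by under eq_fun => k do [have [_ -> _] := uP k]; exact: cvg_cst.
have la : a <= dot (l *m A) l.
  have al : (fun k => a - k.+1%:R^-1) @ ultra_nat --> a.
    rewrite -[X in _ --> X]subr0; apply: cvgB; first exact: cvg_cst.
    exact: cvg_harmonic_ultra.
  apply: ultra_le al (cvg_dot (mcvgM ul (mcvg_cst A)) ul) _.
  by apply: nearW => k; have [] := uP k.
have ge v : v \in V -> 0 <= a * dot v v - dot (v *m A) v.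
  move=> vV; have [->|v0] := eqVneq v 0; first by rewrite mul0mx !dot0l mulr0 subrr.
  have [c c0 [cV c1]] := normalize _ vV v0.
  have : dot ((c *: v) *m A) (c *: v) <= a.
    by apply: ub_le_sup; [case: supE|exists (c *: v)].
  rewrite -[X in _ <= X]mulr1 -c1 -scalemxAl !dotZl !dotZr => h.
  have c2 : 0 < c * c by rewrite -expr2 exprn_even_gt0.
  rewrite -(pmulr_rge0 _ c2); lra.
exists l, a; split=> //.
  by apply/eqP => l0; move: l1; rewrite l0 dot0l => /esym/eqP; rewrite oner_eq0.
have [v vE] : exists v, v = l *m A - a *: l by exists (l *m A - a *: l).
have vV : v \in V by rewrite vE rpredB ?memvZ ?VA.
have al : dot (l *m A) l = a.
  by have := ge l lV; rewrite l1 mulr1 => h; lra.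
(* The form [a * dot v v - dot (v *m A) v] is nonnegative on [V] and zero at [l], so its polar form
   vanishes at [l]; taken at the residue [v] of the eigenvalue equation, it is [- dot v v]. *)
have : (dot l v * a - dot (l *m A) v) ^+ 2 <= 0 * (a * dot v v - dot (v *m A) v).
  apply: discr_le => [|t]; first exact: ge.
  have := ge (l + t *: v); rewrite rpredD ?memvZ// => /(_ isT).
  rewrite mulmxDl -scalemxAl !dotDl !dotDr !dotZl !dotZr l1 al (dotC v l).
  rewrite (Asym v l) (dotC v (l *m A)); lra.
rewrite mul0r => b0; have {b0}: dot l v * a - dot (l *m A) v = 0.
  by apply/eqP; rewrite -sqrf_eq0 eq_le b0 sqr_ge0.
rewrite mulrC -dotZl -dotBl -opprB -vE dotNl => /eqP; rewrite oppr_eq0 => /eqP.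
by move/dot_eq0/eqP; rewrite vE subr_eq0 => /eqP.
Qed.

(** * Maximal abelian subalgebras, real roots and reflections *)

Definition abelianv (U : {vspace 'rV[R]_n}) : Prop :=
  forall x y, x \in U -> y \in U -> br x y = 0.

Definition max_abelian (U : {vspace 'rV[R]_n}) : Prop :=
  abelianv U /\ forall x, (forall y, y \in U -> br x y = 0) -> x \in U.

Lemma exists_max_abelian U : abelianv U ->
  exists2 T, max_abelian T & (U <= T)%VS.
Proof.
move: {2}(n - \dim U)%N (leqnn (n - \dim U)) => k.
elim: k U => [|k IHk] U dU aU.
  exists U => //; split=> // x _.
  have -> : U = fullv; last exact: memvf.
  apply/eqP; rewrite eqEdim subvf dimvf /dim /= mul1n.
  by rewrite -subn_eq0 -leqn0.
have [maxU|/existsNP[x /not_implyP[xU /negP xnU]]] :=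
  pselect (forall x, (forall y, y \in U -> br x y = 0) -> x \in U).
  by exists U.
have Ux : abelianv (U + <[x]>)%VS.
  move=> y1 y2 /memv_addP[u uU [_ /vlineP[a ->] ->]].
  move=> /memv_addP[v vU [_ /vlineP[b ->] ->]].
  rewrite brDl !brDr !brZl !brZr brxx !scaler0 (aU u v)// xU// brC xU//.
  by rewrite oppr0 !scaler0 !addr0.
have UUx : (U <= U + <[x]>)%VS by exact: addvSl.
have dlt : (\dim U < \dim (U + <[x]>))%N.
  rewrite ltnNge; apply: contra xnU => d.
  have /eqP -> : U == (U + <[x]>)%VS by rewrite eqEdim UUx d.
  by apply: (subvP (addvSr _ _)); exact: memv_line.
have [|T maxT UT] := IHk _ _ Ux; first by lia.
by exists T => //; apply: subv_trans UT.
Qed.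

(* [X] spans, with [br h X], a real root plane: the operators [ad h' \o ad h] with
   [h'] in [C] commute and are symmetric, so they are scalar on a minimal invariant
   subspace. *)
Lemma exists_root_data (C : {vspace 'rV[R]_n}) h : max_abelian C -> h \in C ->
  h != 0 -> exists X (mu : 'rV[R]_n -> R), [/\ X != 0, br h X != 0 &
    forall h', h' \in C -> br h' (br h X) = mu h' *: X].
Proof.
move=> [abC maxC] hC h0.
have comm h' x : h' \in C -> br h' (br h x) = br h (br h' x).
  by move=> hC'; rewrite brJ (abC h' h)// br0l add0r.
have AT h' x : x *m (ad h *m ad h') = br h' (br h x) by rewrite mulmxA !mul_ad.
(* Injectivity of [ad h] is carried along so that [br h X] is nonzero in the end; the image of
   [ad h] has it by [br_br_eq0]. *)
pose P (V : {vspace 'rV[R]_n}) := [/\ V != 0%VS,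
  forall x, x \in V -> br h x = 0 -> x = 0 &
  forall h' x, h' \in C -> x \in V -> br h' (br h x) \in V].
(* If [h] were central, [ad h] and hence [dot h h] would be zero. *)
have [z hz] : exists z, br h z != 0.
  apply: contrapT => /forallNP H; case/negP: h0; apply/eqP; apply: dot_eq0.
  rewrite /killing_dot /killing (_ : ad h = 0) ?mul0mx ?mxtrace0 ?oppr0//.
  by apply: mulmx_eqP => v; rewrite mul_ad mulmx0; apply/eqP/negPn/negP/H.
have exP : exists d, `[< exists2 V, P V & \dim V = d >].
  pose V := limg (linfun (mulmxr (ad h) : 'rV[R]_n -> 'rV[R]_n)).
  have VP x : reflect (exists y, x = br h y) (x \in V).
    apply: (iffP memv_imgP) => [[y _ ->]|[y ->]].
      by exists y; rewrite lfunE /= mul_ad.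
    by exists y; rewrite ?memvf// lfunE /= mul_ad.
  exists (\dim V); apply/asboolP; exists V => //; split.
  - by apply: contra_neq hz => V0; apply/eqP; rewrite -memv0 -V0; apply/VP; exists z.
  - by move=> _ /VP[y ->]; exact: br_br_eq0.
  - by move=> h' _ hC' /VP[y ->]; apply/VP; exists (br h' (br h y)); rewrite comm.
have [d /asboolP[V PV dV] dmin] := ex_minnP exP.
have [V0 Vinj Vst] := PV.
have mulV h' : h' \in C -> exists a, forall x, x \in V -> br h' (br h x) = a *: x.
  move=> hC'.
  have [|x y|x [a [xV x0 xa]]] := @symmetric_eigenvector V (ad h *m ad h') V0.
  - by move=> x xV; rewrite AT Vst.
  - by rewrite !AT dot_br dot_br opprK -comm.
  exists a => y yV.
  (* The eigenspace inside [V] satisfies [P] again, because the operators commute, so minimality of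
     the dimension makes it all of [V]. *)
  pose K := (V :&: lker (linfun (mulmxr (ad h *m ad h' - a%:M) :
    'rV[R]_n -> 'rV[R]_n)))%VS.
  have KP v : (v \in K) = (v \in V) && (br h' (br h v) == a *: v).
    rewrite memv_cap memv_ker lfunE /= mulmxBr mul_mx_scalar AT.
    by rewrite subr_eq0.
  have PK : P K.
    split.
    - apply: contra_neq x0 => K0; apply/eqP; rewrite -memv0 -K0 KP xV -AT xa.
      exact: eqxx.
    - by move=> v; rewrite KP => /andP[vV _]; exact: Vinj.
    - move=> g v gC; rewrite !KP => /andP[vV /eqP va]; rewrite Vst//=.
      have gg w : br h' (br g w) = br g (br h' w).
        by rewrite brJ (abC h' g)// br0l add0r.
      by rewrite -(comm g _ gC) gg (comm h' (br h v) hC') va !brZr.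
  have KV : K = V.
    apply/eqP; rewrite eqEdim capvSl /= dV; apply: dmin.
    by apply/asboolP; exists K.
  by move: yV; rewrite -{1}KV KP => /andP[_ /eqP].
have XV := memv_pick V; have X0 : vpick V != 0 by rewrite vpick0.
have /(_ _)/cid mu h' : exists a, h' \in C -> forall x, x \in V ->
    br h' (br h x) = a *: x.
  have [/mulV[a H]|nC] := boolP (h' \in C); first by exists a.
  by exists 0.
exists (vpick V), (fun h' => projT1 (mu h')); split=> //.
  by apply: contra_neq X0; exact: Vinj.
by move=> h' hC'; exact: (projT2 (mu h')).
Qed.

(* [phi] is the exponential of the multiple [(pi / om) *: X] of a root vector, a half
   turn in the plane of [t = br X Y] and [Y]. *)
Lemma exists_reflection (C : {vspace 'rV[R]_n}) h : max_abelian C -> h \in C ->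
  h != 0 -> exists phi t, [/\ lie_aut phi, reach phi, t \in C, dot t h != 0 &
    forall p, p \in C -> p *m phi = p - (2 * dot p t / dot t t) *: t].
Proof.
move=> mC hC h0; have [X [mu [X0 hX muE]]] := exists_root_data mC hC h0.
have [abC maxC] := mC.
have muh : mu h < 0.
  have : mu h * dot X X = - dot (br h X) (br h X).
    by rewrite -dotZl -muE// dot_br.
  by have := dot_gt0 X0; have := dot_gt0 hX; nra.
pose a := Num.sqrt (- mu h).
have a0 : 0 < a by rewrite sqrtr_gt0 oppr_gt0.
have aa : a * a = - mu h by rewrite -expr2 sqr_sqrtr// oppr_ge0 ltW.
have [Y YE] : exists Y, Y = a^-1 *: br h X by exists (a^-1 *: br h X).
have Y0 : Y != 0 by rewrite YE scaler_eq0 negb_or invr_eq0 gt_eqF.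
(* The real root in this normalisation: [h'] acts on the plane of [X] and [Y] as [al h'] times a
   quarter turn. *)
pose al h' := - mu h' / a.
have an0 : a != 0 by rewrite gt_eqF.
have hY h' : h' \in C -> br h' Y = - al h' *: X.
  by move=> hC'; rewrite YE brZr muE// scalerA /al mulNr opprK mulrC.
have hXE h' : h' \in C -> br h' X = al h' *: Y.
  move=> hC'; have E : X = (mu h)^-1 *: br h (br h X).
    by rewrite muE// scalerA mulVf ?scale1r// lt_eqF.
  have c : br h' (br h (br h X)) = br h (br h' (br h X)).
    by rewrite brJ (abC h' h)// br0l add0r.
  rewrite {1}E brZr c muE// brZr YE /al !scalerA; congr (_ *: _).
  have -> : mu h = - (a * a) by rewrite aa opprK.
  by field.
pose t := br X Y.
(* Both terms of the Leibniz rule for [br h' (br X Y)] vanish, being multiples of [br Y Y] and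
   [br X X]; maximality of [C] concludes. *)
have tC : t \in C.
  apply: maxC => h' hC'; rewrite (brC t) /t brJ (hXE _ hC') (hY _ hC') brZl brZr !brxx.
  by rewrite !scaler0 addr0 oppr0.
have dot_t h' : h' \in C -> dot t h' = al h' * dot Y Y.
  by move=> hC'; rewrite /t dot_br brC hXE// dotNr opprK dotZr.
have YY := dot_gt0 Y0.
have alh : al h = a by rewrite /al -aa -mulrA mulfV// mulr1.
have th0 : dot t h != 0 by rewrite dot_t// alh mulf_neq0// gt_eqF.
have t0 : t != 0 by apply: contra_neq th0 => ->; rewrite dot0l.
have tt := dot_gt0 t0.
have alt : 0 < al t by move: tt; rewrite dot_t// pmulr_lgt0.
(* [X] rotates the plane of [t] and [om *: Y] with angular speed [om], so [(pi / om) *: X] does with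
   speed [pi]. The vectors of [C] orthogonal to [t] commute with [X], as [al] is proportional to
   [dot t] there. *)
pose om := Num.sqrt (al t).
have om0 : 0 < om by rewrite sqrtr_gt0.
have omn0 : om != 0 by rewrite gt_eqF.
have omom : om * om = al t by rewrite -expr2 sqr_sqrtr// ltW.
have [phi [pa pr pfix prot]] := exp_aut ((pi / om) *: X).
exists phi, t; split=> // p pC.
have tphi : t *m phi = - t.
  apply: (prot t (om *: Y)).
    rewrite brZl brC hXE// scalerN !scalerA -scaleNr; congr (_ *: _).
    by rewrite -omom; field.
  by rewrite brZl brZr scalerA divfK.
pose c := dot p t / dot t t.
have ttn0 : dot t t != 0 by rewrite gt_eqF.
have pt : (p - c *: t) *m phi = p - c *: t.
  have qC : p - c *: t \in C by rewrite rpredB ?memvZ.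
  apply: pfix; rewrite brZl brC hXE//.
  suff -> : al (p - c *: t) = 0 by rewrite scale0r oppr0 scaler0.
  apply/eqP; rewrite -(mulIr_eq0 _ (mulIf (lt0r_neq0 YY))) -dot_t//.
  by rewrite dotC dotBl dotZl /c divfK// subrr.
rewrite -[p in LHS](subrK (c *: t)) mulmxDl pt -scalemxAl tphi scalerN.
by rewrite -addrA -opprD -scalerDl -mulr2n -mulrA mulr_natl.
Qed.

(** * Products of reflections *)

Lemma reach1 : reach 1%:M.
Proof. by exists 0, 0%N => i; exists [::]. Qed.

Lemma reachM psi phi : reach psi -> reach phi -> reach (psi *m phi).
Proof.
move=> [C [m H]] [C' [m' H']]; exists (Num.max C C'), (m + m')%N => i.
have [s [sN sa sC sp]] := H i; have [t [tN ta tC tp]] := H' i.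
exists (s ++ t); split.
- by rewrite size_cat sN tN mulnDl.
- exact/auts_cat.
- move=> x; rewrite mem_cat => /orP[/sC|/tC] /le_trans; apply;
    by rewrite ler_wpM2r ?invr_ge0 ?exprn_ge0// le_max lexx ?orbT.
- by rewrite prodm_cat sp tp.
Qed.

(** Pairing with a basis of [U] maps [C] to a space of smaller dimension, so it has a kernel in
    [C]. *)
Lemma exists_orthogonal (C U : {vspace 'rV[R]_n}) : (\dim U < \dim C)%N ->
  exists h, [/\ h \in C, h != 0 & forall s, s \in U -> dot h s = 0].
Proof.
move=> UC; pose B : 'M[R]_(\dim U, n) := \matrix_i (vbasis U)`_i.
pose f := linfun (mulmxr (gram *m B^T) : 'rV[R]_n -> 'rV[R]_(\dim U)).
have fE h (i : 'I_(\dim U)) : f h 0 i = dot h (vbasis U)`_i.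
  rewrite lfunE /= dot_gram mulmxA !mxE; apply: eq_bigr => j _.
  by rewrite !mxE.
have : (\dim (C :&: lker f) != 0)%N.
  have := limg_ker_dim f C; have : (\dim (f @: C) <= \dim U)%N.
    by rewrite (leq_trans (dimvS (subvf _)))// dimvf /dim /= mul1n.
  move=> h1 h2; rewrite -lt0n -(ltn_add2r (\dim (f @: C))) h2 add0n.
  exact: leq_ltn_trans h1 UC.
rewrite dimv_eq0 => K0; exists (vpick (C :&: lker f)).
have := memv_pick (C :&: lker f); rewrite memv_cap memv_ker => /andP[hC /eqP hf].
split; rewrite ?vpick0// => s sU.
rewrite (coord_vbasis sU); move: (vpick _) hf {hC} => h hf.
elim: (index_enum _) => [|i r IHr]; first by rewrite big_nil dot0r.
by rewrite big_cons dotDr IHr dotZr -fE hf mxE mulr0 addr0.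
Qed.

(* A product of reflections in linearly independent roots has no nonzero fixed
   vector in their span. *)
Lemma exists_coxeter C k : max_abelian C -> (k <= \dim C)%N ->
  exists phi U, [/\ lie_aut phi, reach phi, (U <= C)%VS /\ \dim U = k,
    forall p, p \in C -> p *m phi \in C /\ p *m phi - p \in U &
    forall p, p \in C -> p *m phi = p -> forall s, s \in U -> dot p s = 0].
Proof.
move=> mC; elim: k => [|k IHk] kC.
  exists 1%:M, 0%VS; split; [exact: lie_aut1|exact: reach1| | |].
  - by rewrite sub0v dimv0.
  - by move=> p pC; rewrite mulmx1 subrr mem0v.
  - by move=> p _ _ s; rewrite memv0 => /eqP ->; rewrite dot0r.
have [phi [U [pa pr [UC dU] pU pfix]]] := IHk (ltnW kC).
have [|h [hC h0 hU]] := @exists_orthogonal C U; first by rewrite dU.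
have [sig [t [sa sr tC th sE]]] := exists_reflection mC hC h0.
(* Choosing [h] orthogonal to [U] makes the new root independent of the earlier ones. *)
have tnU : t \notin U by apply: contra th => /hU; rewrite dotC => ->.
have t0 : t != 0 by apply: contraNneq tnU => ->; exact: mem0v.
have tt : dot t t != 0 by rewrite gt_eqF ?dot_gt0.
exists (phi *m sig), (U + <[t]>)%VS; split.
- exact: lie_autM.
- exact: reachM.
- split; first by rewrite subv_add UC -memvE.
  rewrite dimv_disjoint_sum ?dU ?dim_vline ?t0 ?addn1//.
  apply/eqP; rewrite -subv0; apply/subvP => v; rewrite memv_cap.
  move=> /andP[vU /vlineP[c vc]]; move: vU; rewrite vc.
  by rewrite rpredZeq (negbTE tnU) orbF memv0 => /eqP ->; rewrite scale0r.
- move=> p pC; have [pC' ppU] := pU p pC.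
  rewrite mulmxA sE//; split; first by rewrite rpredB ?memvZ.
  by rewrite addrAC memv_add// -scaleNr memvZ ?memv_line.
- move=> p pC; rewrite mulmxA; have [pC' ppU] := pU p pC.
  rewrite sE//; set c := 2 * _ / _ => ppt.
  (* If [p] is fixed by the product, [c *: t] is the displacement of [p] by [phi], which lies in [U]
     while [t] does not. Hence [p] is fixed by both factors. *)
  have c0 : c = 0.
    have : c *: t \in U by rewrite -(subKr (p *m phi) (c *: t)) ppt.
    by rewrite rpredZeq (negbTE tnU) orbF => /eqP.
  have pp : p *m phi = p by move: ppt; rewrite c0 scale0r subr0.
  have pt : dot p t = 0.
    move/eqP: c0; rewrite /c pp mulf_eq0 invr_eq0 (negbTE tt) orbF.
    by rewrite mulf_eq0 pnatr_eq0 => /eqP.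
  move=> _ /memv_addP[u uU [_ /vlineP[b ->] ->]].
  by rewrite dotDr dotZr pt mulr0 addr0 pfix.
Qed.

Lemma max_abelian_orthogonal C : max_abelian C ->
  exists2 T, max_abelian T & forall x z, x \in C -> z \in T -> dot x z = 0.
Proof.
move=> mC; have [phi [U [pa pr [UC dU] pU pfix]]] := exists_coxeter mC (leqnn _).
have {UC dU} UE : U = C by apply/eqP; rewrite eqEdim UC dU /=.
have [y yfix] := reach_fix pr.
have [|T mT yT] := @exists_max_abelian <[y]>%VS.
  by move=> _ _ /vlineP[a ->] /vlineP[b ->]; rewrite brZl brZr brxx !scaler0.
exists T => // x z xC zT.
have zphi : z *m phi = z.
  by apply: yfix; apply: (proj1 mT) => //; apply: (subvP yT); exact: memv_line.
pose f := linfun (mulmxr (phi - 1%:M) : 'rV[R]_n -> 'rV[R]_n).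
have fE v : f v = v *m phi - v by rewrite lfunE /= mulmxBr mulmx1.
(* A vector of [C] fixed by [phi] is orthogonal to [U = C], hence to itself: [phi - 1] is injective
   on [C], and onto by dimension. *)
have fC : (f @: C)%VS = C.
  apply/eqP; rewrite eqEdim; apply/andP; split.
    apply/subvP => _ /memv_imgP[v vC ->]; rewrite fE rpredB//.
    by have [] := pU v vC.
  rewrite limg_dim_eq//; apply/eqP; rewrite -subv0; apply/subvP => v.
  rewrite memv_cap memv_ker fE subr_eq0 memv0 => /andP[vC /eqP vphi].
  by apply/eqP/dot_eq0; apply: pfix => //; rewrite UE.
move: xC; rewrite -{1}fC => /memv_imgP[v vC ->].
by rewrite fE dotBl -{1}zphi dot_aut// subrr.
Qed.

(** * Cartan subalgebras as maximal abelian subalgebras *)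

Lemma memv_bracketv (U V : {vspace 'rV[R]_n}) x y :
  x \in U -> y \in V -> br x y \in bracketv br U V.
Proof.
move=> xU yV; rewrite (coord_vbasis xU) (coord_vbasis yV).
elim: (index_enum 'I_(\dim U)) => [|i r IHr]; first by rewrite big_nil br0l mem0v.
rewrite big_cons brl rpredD// memvZ//.
elim: (index_enum 'I_(\dim V)) => [|j s IHs]; first by rewrite big_nil br0r mem0v.
rewrite big_cons brr rpredD// memvZ//; apply: memv_span.
by apply: allpairs_f; apply: mem_nth; rewrite size_tuple.
Qed.

(** Both directions rest on [br_br_eq0]: nilpotency makes iterated brackets vanish, which then
    collapse to a single one; and if [x] normalises an abelian [C], then [br y (br y x) = 0] for [y]
    in [C], so [x] centralises [C]. *)
Lemma cartan_max_abelian C : is_cartan br C <-> max_abelian C.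
Proof.
split=> [[subC [k nilC] normC]|[abC maxC]].
  have ad0 x y : br x (br x y) = 0 -> br x y = 0 by exact: br_br_eq0.
  have abC : abelianv C.
    move=> x y xC yC.
    have : iter k (br x) y \in iter k (bracketv br C) C.
      elim: {nilC} k => [//|k IHk] /=; exact: memv_bracketv.
    (* For [k = 0] the vector [y] itself is zero; otherwise [ad0] strips off one bracket at a time
       until one is left. *)
    rewrite nilC memv0 => /eqP; case: {nilC} k => [/= ->|k]; first exact: br0r.
    by elim: k => [//|k IHk] /= /ad0.
  split=> // x xC; apply: normC => y yC; rewrite xC//; exact: mem0v.
split.
- by move=> x y xC yC; rewrite abC// mem0v.
- exists 1%N; rewrite /= /bracketv; apply/eqP; rewrite -subv0; apply/span_subvP.
  move=> _ /allpairsP[[x y] /= [xC yC ->]].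
  by rewrite abC ?mem0v// vbasis_mem.
- move=> x normx; apply: maxC => y yC; rewrite brC.
  have yx : br y (br y x) = 0 by rewrite (abC y)// brC rpredN normx.
  by rewrite br_br_eq0 ?oppr0.
Qed.

Lemma orthogonal_cartan :
  (exists C C' : {vspace 'rV[R]_n},
     [/\ is_cartan br C, is_cartan br C' & killing_orthogonal br C C']) /\
  (forall C : {vspace 'rV[R]_n}, is_cartan br C ->
     exists C' : {vspace 'rV[R]_n}, is_cartan br C' /\ killing_orthogonal br C C').
Proof.
have H (C : {vspace 'rV[R]_n}) : is_cartan br C ->
    exists C' : {vspace 'rV[R]_n}, is_cartan br C' /\ killing_orthogonal br C C'.
  move=> /cartan_max_abelian/max_abelian_orthogonal[T /cartan_max_abelian cT CT].
  by exists T.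
split=> //.
have [|C /cartan_max_abelian cC _] := @exists_max_abelian 0%VS.
  by move=> x y; rewrite memv0 => /eqP -> _; rewrite br0l.
by have [C' [cC' CC']] := H C cC; exists C, C'.
Qed.

End CompactLieAlgebra.

(** Conjugation by a Cholesky factor of [P] turns [A] into a skew-symmetric [B], for which the trace
    of [B *m B] is [- frob B]. *)
Lemma mxtrace_sqr_skew (R : realType) n (P A : 'M[R]_n) : posdef P ->
  A *m P + P *m A^T = 0 -> \tr (A *m A) <= 0 /\ (\tr (A *m A) = 0 -> A = 0).
Proof.
move=> /cholesky[S Su ->] AP.
pose B := invmx S *m A *m S.
have BT : B^T = - B.
  apply/eqP; rewrite -addr_eq0 addrC; apply/eqP.
  have -> : B + B^T = invmx S *m (A *m (S *m S^T) + S *m S^T *m A^T) *m (invmx S)^T.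
    rewrite mulmxDr mulmxDl /B !trmx_mul !mulmxA mulVmx// mul1mx.
    have SS : S^T *m (invmx S)^T = 1%:M by rewrite -trmx_mul mulVmx// trmx1.
    by rewrite -(mulmxA _ S^T) SS mulmx1.
  by rewrite AP mulmx0 mul0mx.
have tr2 : \tr (A *m A) = - frob B.
  rewrite frobE BT mulmxN raddfN /= opprK /B !mulmxA mulmxK// -[RHS]mxtrace_mulC.
  by rewrite !mulmxA mulmxV// mul1mx.
rewrite tr2 oppr_le0 frob_ge0; split=> // /eqP; rewrite oppr_eq0 => /eqP.
move=> /frob_eq0 B0.
have -> : A = S *m B *m invmx S.
  by rewrite /B !mulmxA mulmxV// mul1mx mulmxK.
by rewrite B0 mulmx0 mul0mx.
Qed.

(** * Negative definiteness of the Killing form from a bounded adjoint group *)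

Section CompactAdjointGroup.
Variables (R : realType) (n : nat) (br : 'rV[R]_n -> 'rV[R]_n -> 'rV[R]_n).
Implicit Types x y z : 'rV[R]_n.

Hypothesis brl : forall a x y z, br (a *: x + y) z = a *: br x z + br y z.
Hypothesis brC : forall x y, br x y = - br y x.
Hypothesis semisimple : is_semisimple br.

Variables (Gam : set 'M[R]_n) (M : R).
Hypothesis Gam1 : Gam 1%:M.
Hypothesis GamM : forall g h, Gam g -> Gam h -> Gam (g *m h).
Hypothesis GamV : forall g, Gam g -> g \in unitmx /\ Gam (invmx g).
Hypothesis GamB : forall g, Gam g -> nrm g <= M.
Hypothesis GamD : forall z, exists chi : nat -> 'M[R]_n,
  [/\ forall k, Gam (chi k),
      forall k x y, br (x *m chi k) (y *m chi k) = br x y *m chi k,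
      exists C, forall k, nrm (2 ^+ k *: (chi k - 1%:M)) <= C &
      mcvg (fun k => 2 ^+ k *: (chi k - 1%:M)) (ad br z)].

Lemma mcvg_near1 (chi : nat -> 'M[R]_n) (C : R) :
  (forall k, nrm (2 ^+ k *: (chi k - 1%:M)) <= C) -> mcvg chi 1%:M.
Proof.
move=> chiC; apply: mcvg_nrm_le (cvg_ultra (cvg_geometric2 C)) _ => k.
have p2 : (0 : R) < 2 ^+ k by rewrite exprn_gt0.
by rewrite ler_pdivlMr// mulrC -[2 ^+ k]ger0_norm ?(ltW p2)// -nrmZ.
Qed.

(** The derivative at the identity of the homomorphism property of [chi k], whose infinitesimal
    generator is [ad br z]. *)
Lemma jacobi z x y : br z (br x y) = br (br z x) y + br x (br z y).
Proof.
have [chi [_ hchi [C chiC] chil]] := GamD z.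
have chi1 := mcvg_near1 chiC.
rewrite -!(mul_ad brl brC _ z).
apply: mcvg_unique (mcvgM (mcvg_cst (br x y)) chil) _.
pose w k := 2 ^+ k *: (chi k - 1%:M).
rewrite (_ : (fun k => _) = fun k => br (x *m w k) (y *m chi k) +
  br x (y *m w k)); last first.
  apply/funext => k.
  rewrite /w -!scalemxAr (brZl brl) (brZr brl brC) -scalerDr; congr (_ *: _).
  rewrite !mulmxBr !mulmx1 -hchi (brBl brl) (brBr brl brC).
  by rewrite addrA subrK.
have := mcvgD
  (mcvg_br brl brC (mcvgM (mcvg_cst x) chil) (mcvgM (mcvg_cst y) chi1))
  (mcvg_br brl brC (mcvg_cst x) (mcvgM (mcvg_cst y) chil)).
by rewrite mulmx1.
Qed.

(** A central element spans an abelian ideal; semisimplicity enters here. *)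
Lemma center_eq0 z : ad br z = 0 -> z = 0.
Proof.
move=> z0; have zx x : br z x = 0 by rewrite -(mul_ad brl brC) z0 mulmx0.
apply/eqP; rewrite -memv0 -(semisimple (I := <[z]>%VS)) ?memv_line//.
  move=> x _ /vlineP[a ->]; rewrite (brZr brl brC) brC zx oppr0 scaler0.
  exact: mem0v.
exists 1%N; rewrite /= /bracketv; apply/eqP; rewrite -subv0; apply/span_subvP.
move=> _ /allpairsP[[x y] /= [xC yC ->]].
have /vlineP[a ->] := vbasis_mem xC.
by rewrite (brZl brl) zx scaler0 mem0v.
Qed.

(** Differentiating the invariance of [P] makes [ad br z] skew for it, so its square has negative
    trace unless [ad br z = 0]. *)
Lemma killing_dot_gt0 z : z != 0 -> 0 < killing_dot br z z.
Proof.
move=> z0; have [P Ppos PG] := invariant_form Gam1 GamM GamV GamB.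
have [chi [chiG _ [C chiC] chil]] := GamD z.
have skew : ad br z *m P + P *m (ad br z)^T = 0.
  have := mcvgD (mcvgM (mcvgM chil (mcvg_cst P)) (mcvg_tr (mcvg_near1 chiC)))
    (mcvgM (mcvg_cst P) (mcvg_tr chil)).
  rewrite trmx1 mulmx1 => /mcvg_unique; apply.
  apply: mcvg_near (mcvg_cst 0); apply: nearW => k.
  rewrite -!scalemxAl linearZ /= -scalemxAr -scalerDr.
  rewrite mulmxBl mulmxBl PG// mul1mx linearB /= trmx1 mulmxBr mulmx1.
  by rewrite addrA subrK subrr scaler0.
have [le0 eq0] := mxtrace_sqr_skew Ppos skew.
rewrite /killing_dot /killing oppr_gt0 lt_neqAle le0 andbT.
by apply: contra_neq z0 => /eq0 /center_eq0.
Qed.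

(** An invertible automorphism conjugates the operators [ad] among themselves and so preserves
    traces of their products. The bound carries over because [mnorm] is [nrm] after a fixed
    conjugation. *)
Lemma infinitesimal_lie_aut z : exists chi : nat -> 'M[R]_n,
  [/\ forall k, lie_aut br (chi k),
      exists C, forall k, mnorm brl brC killing_dot_gt0
        (2 ^+ k *: (chi k - 1%:M)) <= C &
      mcvg (fun k => 2 ^+ k *: (chi k - 1%:M)) (ad br z)].
Proof.
have [chi [chiG chih [C chiC] chil]] := GamD z; exists chi; split=> //.
  move=> k; split; first exact: chih.
  have [cu _] := GamV (chiG k); set c := chi k.
  have adc x : ad br (x *m c) = invmx c *m ad br x *m c.
    apply: mulmx_eqP => v; rewrite !mulmxA !(mul_ad brl brC).
    by rewrite -chih -/c mulmxKV.
  apply: form_eqP => x y; rewrite -(dot_gram brl brC).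
  have -> : x *m (c *m gram br *m c^T) *m y^T = x *m c *m gram br *m (y *m c)^T.
    by rewrite trmx_mul !mulmxA.
  rewrite -(dot_gram brl brC) /killing_dot /killing !adc; congr (- _).
  rewrite !mulmxA mulmxK// -!mulmxA mxtrace_mulC.
  by rewrite -!mulmxA mulmxV// mulmx1.
exists (nrm (invmx (gram_root brl brC killing_dot_gt0)) * C *
  nrm (gram_root brl brC killing_dot_gt0)) => k.
apply: le_trans (nrmM _ _) _; rewrite ler_wpM2r ?nrm_ge0//.
by apply: le_trans (nrmM _ _) _; rewrite ler_wpM2l ?nrm_ge0.
Qed.

Lemma orthogonal_cartan_of_adjoint_group :
  (exists C C' : {vspace 'rV[R]_n},
     [/\ is_cartan br C, is_cartan br C' & killing_orthogonal br C C']) /\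
  (forall C : {vspace 'rV[R]_n}, is_cartan br C ->
     exists C' : {vspace 'rV[R]_n},
       is_cartan br C' /\ killing_orthogonal br C C').
Proof.
exact: (orthogonal_cartan jacobi infinitesimal_lie_aut).
Qed.

End CompactAdjointGroup.

(** * Calculus *)

Section Calculus.
Variable R : realType.
Implicit Types U V W : normedModType R.

Lemma derive_comp U V W (g : U -> V) (f : V -> W) a v :
  differentiable g a -> differentiable f (g a) ->
  'D_v (fun x => f (g x)) a = 'D_('D_v g a) f (g a).
Proof.
move=> dg df; rewrite !deriveE//; last exact: differentiable_comp.
by rewrite (diff_comp dg df).
Qed.

Lemma near_eq_differentiable V W (f g : V -> W) a :
  (\near a, f a = g a) -> differentiable f a -> differentiable g a.
Proof.
move=> fg df.
have ga : f a = g a by exact: nbhs_singleton fg.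
have gE : g \o shift a = cst (g a) + 'd f a +o_ 0 id.
  apply/eqaddoP => e e0; have /diff_locally/eqaddoP/(_ e e0) := df.
  have fg0 : \forall h \near 0, f (h + a) = g (h + a).
    by move: fg; rewrite (near_shift 0 a); apply: filterS => h /=; rewrite subr0.
  by move=> H; near=> h; rewrite !fctE /= -ga -(near fg0)//; near: h.
have dE := diff_unique (diff_continuous df) gE.
by apply/diff_locallyP; rewrite dE; split=> //; exact: diff_continuous.
Unshelve. all: by end_near. Qed.

Lemma differentiable_epsilon V W (f : V -> W) a (e : R) :
  differentiable f a -> 0 < e ->
  \forall h \near (0 : V), `|f (h + a) - (f a + 'd f a h)| <= e * `|h|.
Proof.
by move=> /diff_locally/eqaddoP H e0; exact: H.
Qed.

Lemma deriveD_dir V W (f : V -> W) a u v : differentiable f a ->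
  'D_(u + v) f a = 'D_u f a + 'D_v f a.
Proof. by move=> df; rewrite !deriveE// linearD. Qed.

Lemma deriveB_dir V W (f : V -> W) a u v : differentiable f a ->
  'D_(u - v) f a = 'D_u f a - 'D_v f a.
Proof. by move=> df; rewrite !deriveE// linearB. Qed.

Lemma deriveZ_dir V W (f : V -> W) a c v : differentiable f a ->
  'D_(c *: v) f a = c *: 'D_v f a.
Proof. by move=> df; rewrite !deriveE// linearZ. Qed.

(** * Symmetry of second derivatives *)

Lemma mean_value_affine V (f : V -> R) a u (t : R) : 0 < t ->
  (forall s, 0 <= s <= t -> differentiable f (s *: u + a)) ->
  exists2 s, 0 < s < t & f (t *: u + a) - f a = 'D_u f (s *: u + a) * t.
Proof.
move=> t0 df.
pose g s := f (s *: u + a).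
have qE s : (fun h : R => h^-1 *: ((g \o shift s) (h *: 1) - g s)) =
    (fun h : R => h^-1 *: ((f \o shift (s *: u + a)) (h *: u) - f (s *: u + a))).
  apply/funext => h; rewrite /g /=; congr (_ *: (f _ - _)).
  by rewrite -[h *: 1]/(h * 1) mulr1 scalerDl addrA.
have dg s : 0 <= s <= t -> is_derive s 1 g ('D_u f (s *: u + a)).
  move=> st; apply: DeriveDef; rewrite /derivable /derive qE//.
  exact: diff_derivable (df s st).
have [||s] := @MVT R g (fun s => 'D_u f (s *: u + a)) 0 t t0.
- by move=> s; rewrite in_itv /= => /andP[s0 st]; apply: dg; rewrite !ltW.
- apply: continuous_in_subspaceT => s; rewrite inE /= in_itv /= => st.
  apply: differentiable_continuous; apply/derivable1_diffP.
  by have [] := dg s st.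
- by rewrite in_itv /= subr0 => st; rewrite /g scale0r add0r => gE; exists s.
Qed.

(** The mean value theorem along [u] for [f (x + t *: v) - f x] leaves a difference of two values of
    ['D_u f], to which differentiability at the single point [a] applies. *)
Lemma second_difference V (f : V -> R) (a u v : V) (e : R) : 0 < e ->
  (\near a, differentiable f a) -> differentiable ('D_u f) a ->
  \forall t \near 0^'+, `|f (t *: u + (t *: v + a)) - f (t *: v + a) -
    f (t *: u + a) + f a - t ^+ 2 * 'D_v ('D_u f) a| <= e * t ^+ 2.
Proof.
move=> e0 df dG; set G := 'D_u f in dG *; set N := `|u| + `|v| + 1.
have N0 : 0 < N by rewrite ltr_wpDl// addr_ge0.
(* The increments have length at most [t * N] and [G] is evaluated at two points, each with an error
   of at most [e * t / 2]. *)
have e1 : 0 < e / (2 * N) by rewrite divr_gt0// mulr_gt0.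
have : \forall h \near (0 : V), differentiable f (h + a) /\
    `|G (h + a) - (G a + 'd G a h)| <= e / (2 * N) * `|h|.
  apply: filterI; last exact: differentiable_epsilon.
  by move: df; rewrite (near_shift 0 a); apply: filterS => h /=; rewrite subr0.
move=> /nbhs_normP[r /= r0 Hr].
have {}Hr h : `|h| < r -> differentiable f (h + a) /\
    `|G (h + a) - (G a + 'd G a h)| <= e / (2 * N) * `|h|.
  by move=> hr; apply: Hr; rewrite /= sub0r normrN.
near=> t.
have t0 : 0 < t by near: t; exact: nbhs_right_gt.
have tr : t * N < r.
  by rewrite -ltr_pdivlMr//; near: t; apply: nbhs_right_lt; rewrite divr_gt0.
have small s b : 0 <= s <= t -> 0 <= b <= t -> `|s *: u + b *: v| <= t * N.
  move=> /andP[s0 st] /andP[b0 bt]; apply: le_trans (ler_normD _ _) _.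
  rewrite !normrZ !ger0_norm// /N !mulrDr mulr1.
  have := ler_wpM2r (normr_ge0 u) st; have := ler_wpM2r (normr_ge0 v) bt.
  by move: t0; lra.
have tt : 0 <= t <= t by rewrite ltW//= lexx.
have zt : 0 <= (0 : R) <= t by rewrite lexx ltW.
have shE s : s *: u + (t *: v + a) = (s *: u + t *: v) + a by rewrite addrA.
have shE0 s : s *: u + a = (s *: u + 0 *: v) + a by rewrite scale0r addr0.
pose phi x := f (x + t *: v) - f x.
have df1 s : 0 <= s <= t -> differentiable f (s *: u + a + t *: v).
  move=> st; rewrite addrAC; apply: (proj1 (Hr _ _)).
  exact: le_lt_trans (small _ _ st tt) tr.
have df2 s : 0 <= s <= t -> differentiable f (s *: u + a).
  move=> st; rewrite shE0; apply: (proj1 (Hr _ _)).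
  exact: le_lt_trans (small _ _ st zt) tr.
have dsh x : differentiable (fun y : V => y + t *: v) x by [].
have dfs s : 0 <= s <= t -> differentiable (fun y => f (y + t *: v)) (s *: u + a).
  by move=> st; apply: differentiable_comp (dsh _) (df1 _ st).
have [s /andP[s0 st]|s /andP[s0 st]] := @mean_value_affine V phi a u t t0.
  apply: differentiableB; [apply: dfs|apply: df2]; exact/andP.
have s01 : 0 <= s <= t by rewrite !ltW.
have -> : 'D_u phi (s *: u + a) = G (s *: u + a + t *: v) - G (s *: u + a).
  rewrite /phi deriveB; [|apply: diff_derivable|apply: diff_derivable].
  - rewrite derive_comp; [|exact: dsh|exact: df1].
    congr (_ - _); congr ('D_ _ f _).
    by rewrite deriveD ?derive_id ?derive_cst ?addr0//; exact: derivable_cst.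
  - exact: dfs.
  - exact: df2.
rewrite /phi (addrAC _ a) => E.
have lE b : 'd G a (s *: u + b *: v) = s * 'd G a u + b * 'd G a v.
  by rewrite linearD !linearZ.
have est b : 0 <= b <= t -> `|G (s *: u + b *: v + a) -
    (G a + (s * 'd G a u + b * 'd G a v))| <= e * t / 2.
  move=> bt; have sb := small _ _ s01 bt.
  have [_] := Hr _ (le_lt_trans sb tr); rewrite lE.
  move=> /le_trans; apply; apply: (@le_trans _ _ (e / (2 * N) * (t * N))).
    by rewrite ler_wpM2l// ltW.
  by rewrite le_eqVlt; apply/orP; left; apply/eqP; field; rewrite gt_eqF.
have h1 := est _ tt; have := est _ zt; rewrite -shE0 => h2.
have {}E : f (t *: u + (t *: v + a)) - f (t *: v + a) - f (t *: u + a) + f a =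
    (G (s *: u + t *: v + a) - G (s *: u + a)) * t.
  by rewrite (addrAC (s *: u)) -E addrA (addrC (t *: v) a); lra.
rewrite E (deriveE _ dG).
move: h1 h2; move: (G _) (G (s *: u + a)) (G a) ('d G a u) ('d G a v) => A B C D F.
rewrite !ler_norml => /andP[a1 a2] /andP[b1 b2].
have -> : (A - B) * t - t ^+ 2 * F = t * (A - B - t * F) by ring.
have -> : e * t ^+ 2 = t * (e * t) by ring.
by rewrite -mulrN !ler_pM2l//; apply/andP; split; lra.
Unshelve. all: by end_near. Qed.

(** The second difference is symmetric in [u] and [v], and both mixed derivatives approximate it. *)
Lemma derive_commute_real V (f : V -> R) (a u v : V) :
  (\near a, differentiable f a) -> differentiable ('D_u f) a ->
  differentiable ('D_v f) a -> 'D_u ('D_v f) a = 'D_v ('D_u f) a.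
Proof.
move=> df du dv; apply/eqP; rewrite -subr_eq0 -normr_le0; apply/ler_addgt0Pl => e e0.
rewrite addr0; have e2 : 0 < e / 2 by rewrite divr_gt0.
have H1 := second_difference v e2 df du.
have H2 := second_difference u e2 df dv.
have [t [t0 [h1 h2]]] := filter_ex (filterI (nbhs_right_gt (0 : R)) (filterI H1 H2)).
have sw : t *: v + (t *: u + a) = t *: u + (t *: v + a) by rewrite addrCA.
have T0 : 0 < t ^+ 2 by rewrite exprn_gt0.
rewrite -(@ler_pM2l _ (t ^+ 2))// -{1}[t ^+ 2]gtr0_norm// -normrM.
move: h1 h2 T0; rewrite /= sw.
move: (t ^+ 2) ('D_u ('D_v f) a) ('D_v ('D_u f) a) (f (t *: u + (t *: v + a))).
move: (f (t *: v + a)) (f (t *: u + a)) (f a) => p q r T A B w.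
rewrite !ler_norml => /andP[a1 a2] /andP[b1 b2] T0.
by apply/andP; split; lra.
Qed.

Lemma derive_coord V n (f : V -> 'rV[R]_n) a v i : differentiable f a ->
  'D_v (fun x => f x 0 i) a = ('D_v f a) 0 i.
Proof.
move=> df.
have dc : differentiable (fun N : 'rV[R]_n => N 0 i : R) (f a).
  exact: differentiable_coord.
rewrite (derive_comp v df dc) /derive; apply: cvg_lim => //.
apply: (@cvg_trans _ ((fun=> ('D_v f a) 0 i) @ (0 : R)^')); last exact: cvg_cst.
apply: near_eq_cvg; apply: (@filterS _ _ _ (fun h : R => h != 0)) (nbhs_dnbhs_neq _).
by move=> h h0 /=; rewrite !mxE addrK -[RHS]/(_ * (_ * _)) mulrA mulVf ?mul1r.
Qed.

Lemma derive_commute V n (f : V -> 'rV[R]_n) (a u v : V) :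
  (\near a, differentiable f a) -> differentiable ('D_u f) a ->
  differentiable ('D_v f) a -> 'D_u ('D_v f) a = 'D_v ('D_u f) a.
Proof.
move=> df du dv; apply/rowP => i.
apply: (etrans (esym (derive_coord u i dv))).
apply: (etrans _ (derive_coord v i du)).
pose fi x : R := f x 0 i.
have fiE w : \near a, ('D_w f a) 0 i = 'D_w fi a.
  by apply: filterS df => x dx; exact: esym (derive_coord w i dx).
have dco (g : V -> 'rV[R]_n) x : differentiable g x ->
    differentiable (fun y => g y 0 i : R) x.
  by move=> dg; apply: differentiable_comp dg (differentiable_coord _ _ _).
apply: (etrans (near_eq_derive u (fiE v))).
apply: (etrans _ (esym (near_eq_derive v (fiE u)))).
apply: derive_commute_real.
- by apply: filterS df => x; exact: dco.
- by apply: near_eq_differentiable (fiE u) _; exact: dco.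
- by apply: near_eq_differentiable (fiE v) _; exact: dco.
Qed.

End Calculus.

(** * Brackets of related vector fields *)

Section RelatedFields.
Variables (R : realType) (n : nat).
Local Notation V := 'rV[R]_n.
Implicit Types (F X Y : V -> V) (a u v w : V).

Lemma derive_basis F a w : differentiable F a ->
  'D_w F a = \sum_i w 0 i *: 'D_(delta_mx 0 i) F a.
Proof.
move=> dF; rewrite deriveE// {1}(row_sum_delta w) linear_sum.
by apply: eq_bigr => i _; rewrite linearZ deriveE.
Qed.

(** Leibniz rule for a derivative whose direction varies with the point; expanding [Y] in the
    standard basis reduces it to products of real functions. *)
Lemma derive_apply_coord F Y a u j : (\near a, differentiable F a) ->
  (forall w, differentiable ('D_w F) a) -> differentiable Y a ->
  'D_u (fun x => ('D_(Y x) F x) 0 j) a =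
  ('D_('D_u Y a) F a + 'D_u ('D_(Y a) F) a) 0 j.
Proof.
move=> dF dDF dY.
pose G i : V -> R := fun x => ('D_(delta_mx 0 i) F x) 0 j.
pose y i : V -> R := fun x => Y x 0 i.
have dFa := nbhs_singleton dF.
have dG i : differentiable (G i) a.
  exact: differentiable_comp (dDF _) (differentiable_coord _ _ _).
have dy i : differentiable (y i) a.
  exact: differentiable_comp dY (differentiable_coord _ _ _).
have GE i : 'D_u (G i) a = ('D_u ('D_(delta_mx 0 i) F) a) 0 j.
  exact: (derive_coord u j (dDF _)).
have yE i : 'D_u (y i) a = ('D_u Y a) 0 i by exact: (derive_coord u i dY).
have E1 : \near a, ('D_(Y a) F a) 0 j = (\sum_i (y i * G i)) a.
  apply: filterS dF => x dx; rewrite derive_basis// summxE fct_sumE.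
  by apply: eq_bigr => i _; rewrite mxE.
apply: (etrans (near_eq_derive u E1)).
rewrite derive_sum; last first.
  by move=> i; apply: derivableM; exact: diff_derivable.
rewrite mxE.
have -> : ('D_u ('D_(Y a) F) a) 0 j = \sum_i Y a 0 i * 'D_u (G i) a.
  apply: (etrans (esym (derive_coord u j (dDF (Y a))))).
  have E2 : \forall x \near a, ('D_(Y a) F x) 0 j = (\sum_i (Y a 0 i *: G i)) x.
    apply: filterS dF => x dx; rewrite derive_basis// summxE fct_sumE.
    by apply: eq_bigr => i _; rewrite mxE.
  apply: (etrans (near_eq_derive u E2)); rewrite derive_sum.
    by apply: eq_bigr => i _; rewrite deriveZ//; exact: diff_derivable.
  by move=> i; apply: derivableZ; exact: diff_derivable.
rewrite derive_basis// summxE -big_split; apply: eq_bigr => i _ /=.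
rewrite deriveM ?mxE; [|exact: diff_derivable|exact: diff_derivable].
by rewrite addrC yE; congr (_ + _); rewrite -[LHS]/(_ * _) mulrC.
Qed.

(* The second-order terms cancel because second derivatives of [F] commute. *)
Lemma related_field_bracket F X Y X' Y' a : (\near a, differentiable F a) ->
  (forall w, differentiable ('D_w F) a) ->
  differentiable X a -> differentiable Y a ->
  differentiable X' (F a) -> differentiable Y' (F a) ->
  (\near a, 'D_(X a) F a = X' (F a)) -> (\near a, 'D_(Y a) F a = Y' (F a)) ->
  'D_(field_bracket X Y a) F a = field_bracket X' Y' (F a).
Proof.
move=> dF dDF dX dY dX' dY' XX' YY'.
have dFa := nbhs_singleton dF.
(* Both sides of the relation between [Z] and [Z'] are differentiated along [u]. *)
have key (Z Z' : V -> V) u j : differentiable Z a -> differentiable Z' (F a) ->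
    (\near a, 'D_(Z a) F a = Z' (F a)) ->
    ('D_('D_u Z a) F a + 'D_u ('D_(Z a) F) a) 0 j = ('D_('D_u F a) Z' (F a)) 0 j.
  move=> dZ dZ' ZZ'.
  apply: (etrans (esym (derive_apply_coord u j dF dDF dZ))).
  have E : \near a, ('D_(Z a) F a) 0 j = Z' (F a) 0 j.
    by apply: filterS ZZ' => x ->.
  apply: (etrans (near_eq_derive u E)).
  have dZF : differentiable (fun x => Z' (F x)) a by exact: differentiable_comp.
  apply: (etrans (derive_coord u j dZF)).
  by have -> := derive_comp u dFa dZ'.
apply/rowP => j; rewrite /field_bracket.
have XXa := nbhs_singleton XX'; have YYa := nbhs_singleton YY'.
apply: (etrans (congr1 (fun z : V => z 0 j) (deriveB_dir _ _ dFa))).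
have kY := key Y Y' (X a) j dY dY' YY'; have kX := key X X' (Y a) j dX dX' XX'.
have sw := derive_commute dF (dDF (X a)) (dDF (Y a)).
have aux (A A2 B C C2 E : V) : (A + B) 0 j = C 0 j -> (A2 + E) 0 j = C2 0 j ->
    E = B -> (A - A2) 0 j = (C - C2) 0 j.
  by move=> + + EB; rewrite EB !mxE => <- <-; ring.
have {}kY : ('D_('D_(X a) Y a) F a + 'D_(X a) ('D_(Y a) F) a) 0 j =
    ('D_(X' (F a)) Y' (F a)) 0 j by rewrite kY XXa.
have {}kX : ('D_('D_(Y a) X a) F a + 'D_(Y a) ('D_(X a) F) a) 0 j =
    ('D_(Y' (F a)) X' (F a)) 0 j by rewrite kX YYa.
exact: aux kY kX (esym sw).
Qed.

End RelatedFields.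

(** * The adjoint representation of a Lie group *)

Section PartialDerivatives.
Variables (R : realType) (U V W : normedModType R).
Implicit Types f : U * V -> W.

Lemma differentiable_pairr (x : U) (y : V) : differentiable (fun y => (x, y)) y.
Proof. exact: differentiable_pair. Qed.

Lemma differentiable_pairl (x : U) (y : V) : differentiable (fun x => (x, y)) x.
Proof. exact: differentiable_pair. Qed.

Lemma differentiable_slicer f x y : differentiable f (x, y) ->
  differentiable (fun y => f (x, y)) y.
Proof. by move=> df; apply: (differentiable_comp (differentiable_pairr x y)). Qed.

Lemma differentiable_slicel f x y : differentiable f (x, y) ->
  differentiable (fun x => f (x, y)) x.
Proof. by move=> df; apply: (differentiable_comp (differentiable_pairl x y)). Qed.

Lemma derive_pairr f x y v : differentiable f (x, y) ->
  'D_v (fun y => f (x, y)) y = 'D_(0, v) f (x, y).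
Proof.
move=> df; apply: (etrans (derive_comp v (differentiable_pairr x y) df)).
have dp : is_diff y (fun y : V => (x, y)) (fun v => (0, v)).
  exact: (is_diff_pair (is_diff_cst x y) (is_diff_id y)).
have -> // : 'D_v (fun y => (x, y)) y = (0, v).
by rewrite deriveE; [rewrite diff_val|exact: differentiable_pairr].
Qed.

Lemma derive_pairl f x y v : differentiable f (x, y) ->
  'D_v (fun x => f (x, y)) x = 'D_(v, 0) f (x, y).
Proof.
move=> df; apply: (etrans (derive_comp v (differentiable_pairl x y) df)).
have dp : is_diff x (fun x : U => (x, y)) (fun v => (v, 0)).
  exact: (is_diff_pair (is_diff_id x) (is_diff_cst y x)).
have -> // : 'D_v (fun x => (x, y)) x = (v, 0).
by rewrite deriveE; [rewrite diff_val|exact: differentiable_pairl].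
Qed.

End PartialDerivatives.

(** * Charts and translations *)

Section Charts.
Variables (R : realType) (n : nat) (G : lieGroup R n).
Local Notation V := 'rV[R]_n.
Implicit Types (k : chart R n G) (g h : G) (x y : V).
Local Open Scope group_scope.

Lemma chart_im_map k g : chart_dom k g -> chart_im k (k g).
Proof. by move=> kg; exists g. Qed.

Lemma chart_inv_dom k x : chart_im k x ->
  chart_dom k (chart_inv k x) /\ k (chart_inv k x) = x.
Proof. by move=> [g kg <-]; rewrite chartK. Qed.

Lemma chart_dom_near k g : chart_dom k g -> \near g, chart_dom k g.
Proof. by move=> kg; apply: open_nbhs_nbhs; split=> //; exact: chart_dom_open. Qed.

Lemma chart_im_near k x : chart_im k x -> \near x, chart_im k x.
Proof. by move=> kx; apply: open_nbhs_nbhs; split=> //; exact: chart_im_open. Qed.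

Lemma chart_continuous_at k g : chart_dom k g -> {for g, continuous k}.
Proof.
move=> kg; have := @chart_continuous _ _ _ k.
rewrite continuous_open_subspace; last exact: chart_dom_open.
by apply; rewrite inE.
Qed.

Lemma chart_inv_continuous_at k x : chart_im k x ->
  {for x, continuous (chart_inv k)}.
Proof.
move=> kx; have := @chart_inv_continuous _ _ _ k.
rewrite continuous_open_subspace; last exact: chart_im_open.
by apply; rewrite inE.
Qed.

Lemma mulg_cvg (T : Type) (F : set_system T) {FF : Filter F} (f f' : T -> G) g h :
  f @ F --> g -> f' @ F --> h -> (fun t => f t * f' t) @ F --> g * h.
Proof.
move=> fg f'h; apply: (continuous2_cvg _ _ fg f'h).
exact: (@lie_mul_continuous R n G (g, h)).
Qed.

Lemma translate_continuous g h : continuous (fun p : G => g * p * h).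
Proof.
move=> p; apply: mulg_cvg; last exact: cvg_cst.
by apply: mulg_cvg; [exact: cvg_cst|exact: cvg_id].
Qed.

Lemma translate_near (P : set G) p : (\forall h \near (1 : G), P h) ->
  \forall g \near p, P (g * p^-1).
Proof.
move=> P1; have tc : (fun g => g * p^-1) @ p --> (1 : G).
  by rewrite -(mulgV p); apply: mulg_cvg; [exact: cvg_id|exact: cvg_cst].
exact: tc _ P1.
Qed.

Lemma translate_chart_cvg k g h p : chart_dom k p ->
  (fun y => g * chart_inv k y * h) @ k p --> g * p * h.
Proof.
move=> kp; have kc : chart_inv k @ k p --> p.
  rewrite -[X in _ --> X](chartK kp).
  exact: (chart_inv_continuous_at (chart_im_map kp)).
exact: (cvg_comp _ _ kc (@translate_continuous g h p)).
Qed.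

Definition mul_chart k1 k2 k3 (z : V * V) : V :=
  k3 (chart_inv k1 z.1 * chart_inv k2 z.2).

Definition mul_chart_dom k1 k2 k3 : set (V * V) := [set z |
  [/\ chart_im k1 z.1, chart_im k2 z.2 &
      chart_dom k3 (chart_inv k1 z.1 * chart_inv k2 z.2)]].

Lemma mul_chart_dom_near k1 k2 k3 z : mul_chart_dom k1 k2 k3 z ->
  \near z, mul_chart_dom k1 k2 k3 z.
Proof.
move=> [k1z k2z k3z].
have c1 : (fun w : V * V => chart_inv k1 w.1) @ z --> chart_inv k1 z.1.
  apply: (@cvg_comp _ _ _ fst _ _ (nbhs z.1)); first exact: cvg_fst.
  exact: chart_inv_continuous_at.
have c2 : (fun w : V * V => chart_inv k2 w.2) @ z --> chart_inv k2 z.2.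
  apply: (@cvg_comp _ _ _ snd _ _ (nbhs z.2)); first exact: cvg_snd.
  exact: chart_inv_continuous_at.
near=> w; split; near: w.
- by apply: (@cvg_fst _ _ (nbhs z.1) (nbhs z.2)); exact: chart_im_near.
- by apply: (@cvg_snd _ _ (nbhs z.1) (nbhs z.2)); exact: chart_im_near.
- exact: (mulg_cvg c1 c2 (chart_dom_near k3z)).
Unshelve. all: by end_near. Qed.

Lemma mul_chart_smooth k1 k2 k3 vs z : lie_atlas k1 -> lie_atlas k2 ->
  lie_atlas k3 -> mul_chart_dom k1 k2 k3 z ->
  differentiable (iter_derive vs (mul_chart k1 k2 k3)) z.
Proof. by move=> a1 a2 a3 dz; exact: (lie_mul_smooth a1 a2 a3). Qed.

(** Two products in succession pass through an intermediate chart around [g * p]; the composite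
    agrees with the translation as long as the first product stays in that chart. *)
Lemma differentiable_translate k1 k2 g h p : lie_atlas k1 -> lie_atlas k2 ->
  chart_dom k1 p -> chart_dom k2 (g * p * h) ->
  differentiable (fun y => k2 (g * chart_inv k1 y * h)) (k1 p).
Proof.
move=> a1 a2 k1p k2gph.
have [kg ag kgg] := lie_cover g; have [kh ah khh] := lie_cover h.
have [k' a' k'gp] := lie_cover (g * p).
pose f1 y := mul_chart kg k1 k' (kg g, y).
pose f2 q := mul_chart k' kh k2 (q, kh h).
have f1E y : f1 y = k' (g * chart_inv k1 y) by rewrite /f1 /mul_chart /= chartK.
have f2E q : f2 q = k2 (chart_inv k' q * h) by rewrite /f2 /mul_chart /= chartK.
have df1 : differentiable f1 (k1 p).
  apply: differentiable_slicer.
  apply: (mul_chart_smooth [::]) => //.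
  by split=> /=; rewrite ?chartK//; exact: chart_im_map.
have f1p : f1 (k1 p) = k' (g * p) by rewrite f1E chartK.
have df2 : differentiable f2 (f1 (k1 p)).
  rewrite f1p; apply: differentiable_slicel.
  apply: (mul_chart_smooth [::]) => //.
  by split=> /=; rewrite ?chartK//; exact: chart_im_map.
apply: near_eq_differentiable (differentiable_comp df1 df2).
have := @translate_chart_cvg k1 g 1 p k1p; rewrite mulg1 => cg.
have k'near : \forall y \near k1 p, chart_dom k' (g * chart_inv k1 y * 1).
  exact: cg _ (chart_dom_near k'gp).
apply: filterS k'near => y; rewrite mulg1 => k'y.
by rewrite /= f2E f1E chartK.
Qed.

End Charts.

(** * Left-invariant fields and the adjoint representation *)

Section AdjointRepresentation.
Variables (R : realType) (n : nat) (G : lieGroup R n) (c : chart R n G).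
Hypothesis c_atlas : lie_atlas c.
Hypothesis c_id : chart_dom c (1%g : G).
Local Notation V := 'rV[R]_n.
Local Notation e := (c 1%g).
Local Notation ci := (chart_inv c).
Local Notation m := (mul_chart c c c).
Local Notation X := (left_invariant_field c).
Implicit Types (g h : G) (x y u v w : V).
Local Open Scope group_scope.

Lemma chart_im1 : chart_im c e. Proof. exact: chart_im_map. Qed.

Lemma chart_inv1 : ci e = 1. Proof. exact: chartK. Qed.

Lemma mul_chart_dom1r x : chart_im c x -> mul_chart_dom c c c (x, e).
Proof.
move=> cx; split=> //=; first exact: chart_im1.
by rewrite chart_inv1 mulg1; case: (chart_inv_dom cx).
Qed.

Lemma mul_chart_dom1l x : chart_im c x -> mul_chart_dom c c c (e, x).
Proof.
move=> cx; split=> //=; first exact: chart_im1.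
by rewrite chart_inv1 mul1g; case: (chart_inv_dom cx).
Qed.

Lemma mul_chart1r x : chart_im c x -> m (x, e) = x.
Proof.
by move=> cx; rewrite /mul_chart /= chart_inv1 mulg1; case: (chart_inv_dom cx).
Qed.

Lemma mul_chart1l x : chart_im c x -> m (e, x) = x.
Proof.
by move=> cx; rewrite /mul_chart /= chart_inv1 mul1g; case: (chart_inv_dom cx).
Qed.

Lemma differentiable_mul z : mul_chart_dom c c c z -> differentiable m z.
Proof. exact: (mul_chart_smooth [::]). Qed.

Lemma differentiable_D_mul (w z : V * V) : mul_chart_dom c c c z ->
  differentiable ('D_w m) z.
Proof. exact: (mul_chart_smooth [:: w]). Qed.

Lemma fieldE x v : chart_im c x -> X v x = 'D_(0, v) m (x, e).
Proof.
by move=> cx; apply: derive_pairr; apply: differentiable_mul; exact: mul_chart_dom1r.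
Qed.

Lemma differentiable_field v x : chart_im c x -> differentiable (X v) x.
Proof.
move=> cx; apply: (@near_eq_differentiable _ _ _ (fun x => 'D_(0, v) m (x, e))).
  by apply: filterS (chart_im_near cx) => y cy; rewrite fieldE.
apply: (@differentiable_slicel _ _ _ _ ('D_(0, v) m)).
exact/differentiable_D_mul/mul_chart_dom1r.
Qed.

Lemma field1 v : X v e = v.
Proof.
rewrite -[RHS](derive_id e v); apply: near_eq_derive.
apply: filterS (chart_im_near chart_im1) => y cy.
by rewrite chart_inv1 mul1g; case: (chart_inv_dom cy).
Qed.

Lemma field_lin a u v x : chart_im c x -> X (a *: u + v)%R x = (a *: X u x + X v x)%R.
Proof.
move=> cx; rewrite !fieldE//.
have dm := differentiable_mul (mul_chart_dom1r cx).
rewrite -(deriveZ_dir _ _ dm) -(deriveD_dir _ _ dm); congr ('D_ _ m _).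
by rewrite -[RHS]/((a *: 0 + 0)%R, (a *: u + v)%R) scaler0 addr0.
Qed.

Lemma lie_bracketl a u v w :
  lie_bracket c (a *: u + v)%R w = (a *: lie_bracket c u w + lie_bracket c v w)%R.
Proof.
have dX z := differentiable_field z chart_im1.
rewrite /lie_bracket /field_bracket !field1.
have -> : 'D_w (X (a *: u + v)%R) e = (a *: 'D_w (X u) e + 'D_w (X v) e)%R.
  have E : \forall x \near e, X (a *: u + v)%R x = (a *: X u + X v)%R x.
    by apply: filterS (chart_im_near chart_im1) => x cx; rewrite field_lin.
  apply: (etrans (near_eq_derive w E)).
  have du : derivable (X u) e w by exact: diff_derivable.
  have dv : derivable (X v) e w by exact: diff_derivable.
  have dau : derivable (a *: X u)%R e w by exact: derivableZ.
  by apply: (etrans (deriveD dau dv)); rewrite deriveZ.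
rewrite (deriveD_dir _ _ (dX w)) (deriveZ_dir _ _ (dX w)).
have aux (y z y' z' : V) :
    (a *: y + z - (a *: y' + z') = a *: (y - y') + (z - z'))%R.
  by rewrite scalerBr opprD addrACA.
exact: aux.
Qed.

Lemma lie_bracketC u v : lie_bracket c u v = (- lie_bracket c v u)%R.
Proof. by rewrite /lie_bracket /field_bracket opprB. Qed.

(** Conjugation by [g^-1], so that [adm g] is Ad(g^-1): with matrices acting from the right, this is
    what makes [adm] multiplicative. *)
Definition conj_chart g y : V := c (g^-1 * ci y * g).

Definition adm g : 'M[R]_n := lin1_mx ('d (conj_chart g) e).

Lemma differentiable_conj g : differentiable (conj_chart g) e.
Proof. by apply: differentiable_translate; rewrite // mulg1 mulVg. Qed.

Lemma mul_adm g v : v *m adm g = 'D_v (conj_chart g) e.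
Proof. by rewrite mul_rV_lin1 deriveE//; exact: differentiable_conj. Qed.

Lemma conj_chart1 g : conj_chart g e = e.
Proof. by rewrite /conj_chart chart_inv1 mulg1 mulVg. Qed.

Lemma conj_chartK g : \forall y \near e, ci (conj_chart g y) = g^-1 * ci y * g.
Proof.
have := @translate_chart_cvg _ _ _ c g^-1 g 1 c_id.
rewrite mulg1 mulVg => cg.
have cnear : \forall y \near e, chart_dom c (g^-1 * ci y * g).
  exact: cg _ (chart_dom_near c_id).
by apply: filterS cnear => y cy; rewrite chartK.
Qed.

Lemma adm1 : adm 1 = 1%:M.
Proof.
apply: mulmx_eqP => v; rewrite mulmx1 mul_adm -[RHS](derive_id e v).
apply: near_eq_derive; apply: filterS (chart_im_near chart_im1) => y cy.
by rewrite /conj_chart invg1 mul1g mulg1; case: (chart_inv_dom cy).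
Qed.

Lemma admM g h : adm (g * h) = adm g *m adm h.
Proof.
apply: mulmx_eqP => v; apply: (etrans (mul_adm _ v)); rewrite mulmxA.
apply: (etrans _ (esym (mul_adm h _))); have -> := mul_adm g v.
have E : \forall y \near e, conj_chart (g * h) y = conj_chart h (conj_chart g y).
  apply: filterS (conj_chartK g) => y cy.
  by rewrite {2}/conj_chart cy /conj_chart invgM !mulgA.
have dh : differentiable (conj_chart h) (conj_chart g e).
  by rewrite conj_chart1; exact: differentiable_conj.
apply: (etrans (near_eq_derive v E)).
apply: (etrans (derive_comp v (differentiable_conj g) dh)).
by rewrite conj_chart1.
Qed.

Lemma adm_unit g : adm g \in unitmx /\ invmx (adm g) = adm g^-1.
Proof.
have gK : adm g *m adm g^-1 = 1%:M by rewrite -admM mulgV adm1.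
have [gu _] := mulmx1_unit gK; split=> //.
by rewrite -[LHS]mulmx1 -gK mulmxA mulVmx// mul1mx.
Qed.

(** * Left and right translations by a fixed element *)

Section Translations.
Variable g : G.
Hypothesis cg : chart_dom c g.
Local Notation a := (c g).

Definition ltrans x : V := m (a, x).
Definition rtrans x : V := m (x, a).

Lemma chart_ima : chart_im c a. Proof. exact: chart_im_map. Qed.

Lemma ltrans1 : ltrans e = a. Proof. exact: mul_chart1r chart_ima. Qed.
Lemma rtrans1 : rtrans e = a. Proof. exact: mul_chart1l chart_ima. Qed.

Lemma near_dom_r : \forall x \near e, mul_chart_dom c c c (x, a).
Proof.
apply: (differentiable_continuous (differentiable_pairl e a)).
exact/mul_chart_dom_near/mul_chart_dom1l/chart_ima.
Qed.

Lemma near_dom_l : \forall x \near e, mul_chart_dom c c c (a, x).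
Proof.
apply: (differentiable_continuous (differentiable_pairr a e)).
exact/mul_chart_dom_near/mul_chart_dom1r/chart_ima.
Qed.

Lemma near_dom_at x : chart_im c x -> \forall y \near e, mul_chart_dom c c c (x, y).
Proof.
move=> cx; apply: (differentiable_continuous (differentiable_pairr x e)).
exact/mul_chart_dom_near/mul_chart_dom1r.
Qed.

Lemma differentiable_rtrans x : mul_chart_dom c c c (x, a) ->
  differentiable rtrans x.
Proof.
move=> dx; apply: differentiable_slicel.
exact: differentiable_mul.
Qed.

Lemma differentiable_ltrans x : mul_chart_dom c c c (a, x) ->
  differentiable ltrans x.
Proof.
move=> dx; apply: differentiable_slicer.
exact: differentiable_mul.
Qed.

Lemma differentiable_D_rtrans w : differentiable ('D_w rtrans) e.
Proof.
apply: (@near_eq_differentiable _ _ _ (fun x => 'D_(w, 0) m (x, a))).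
  apply: filterS near_dom_r => x dx; apply/esym/derive_pairl.
  exact: differentiable_mul.
apply: (@differentiable_slicel _ _ _ _ ('D_(w, 0) m)).
exact/differentiable_D_mul/mul_chart_dom1l/chart_ima.
Qed.

Lemma differentiable_D_ltrans w : differentiable ('D_w ltrans) e.
Proof.
apply: (@near_eq_differentiable _ _ _ (fun x => 'D_(0, w) m (a, x))).
  apply: filterS near_dom_l => x dx; apply/esym/derive_pairr.
  exact: differentiable_mul.
apply: (@differentiable_slicer _ _ _ _ ('D_(0, w) m)).
exact/differentiable_D_mul/mul_chart_dom1r/chart_ima.
Qed.

(** Differentiate [(x * y) * g = (x * g) * (g^-1 * y * g)] in [y] at the identity. *)
Lemma field_rtrans v x : mul_chart_dom c c c (x, a) ->
  'D_(X v x) rtrans x = X (v *m adm g) (rtrans x).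
Proof.
move=> dx; have [/= cx _ cxa] := dx.
rewrite mul_adm.
have dr : differentiable rtrans (m (x, e)).
  by rewrite mul_chart1r//; exact: differentiable_rtrans.
have dm : differentiable (fun y => m (x, y)) e.
  apply: differentiable_slicer.
  exact/differentiable_mul/mul_chart_dom1r.
have cr : chart_im c (rtrans x) by exact: chart_im_map.
have dm' : differentiable (fun y => m (rtrans x, y)) (conj_chart g e).
  rewrite conj_chart1; apply: differentiable_slicer.
  exact/differentiable_mul/mul_chart_dom1r.
have E : \forall y \near e, rtrans (m (x, y)) = m (rtrans x, conj_chart g y).
  apply: filterS (filterI (near_dom_at cx) (conj_chartK g)) => y [[_ _ /= dxy] cy].
  rewrite /rtrans /mul_chart /= cy !chartK//; last by move: cxa; rewrite chartK.
  by rewrite !mulgA mulgK.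
have := derive_comp v dm dr; rewrite mul_chart1r// => <-.
apply: (etrans (near_eq_derive v E)).
apply: (etrans (derive_comp v (differentiable_conj g) dm')).
by rewrite conj_chart1.
Qed.

Lemma field_ltrans v x : mul_chart_dom c c c (a, x) ->
  'D_(X v x) ltrans x = X v (ltrans x).
Proof.
move=> dx; have [/= _ cx cxa] := dx.
have dr : differentiable ltrans (m (x, e)).
  by rewrite mul_chart1r//; exact: differentiable_ltrans.
have dm : differentiable (fun y => m (x, y)) e.
  apply: differentiable_slicer.
  exact/differentiable_mul/mul_chart_dom1r.
have E : \forall y \near e, ltrans (m (x, y)) = m (ltrans x, y).
  apply: filterS (near_dom_at cx) => y [_ _ /= dxy].
  rewrite /ltrans /mul_chart /= !chartK//; last by move: cxa; rewrite chartK.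
  by rewrite mulgA.
have := derive_comp v dm dr; rewrite mul_chart1r// => <-.
exact: (near_eq_derive v E).
Qed.

Lemma field_inj v w : X v a = X w a -> v = w.
Proof.
(* Left translation by [g^-1] recovers [v] from the value of its field at [g]; the factor 1 fits the
   two-sided form of [differentiable_translate]. *)
pose s y := c (g^-1 * ci y * 1).
have ds : differentiable s a.
  by apply: differentiable_translate; rewrite // mulg1 mulVg.
have sX v' : 'D_(X v' a) s a = v'.
  have dm : differentiable (fun y => m (a, y)) e.
    apply: differentiable_slicer.
    exact/differentiable_mul/mul_chart_dom1r/chart_ima.
  have ds' : differentiable s (m (a, e)) by rewrite mul_chart1r//; exact: chart_ima.
  have := derive_comp v' dm ds'; rewrite mul_chart1r; last exact: chart_ima.
  move=> <-; rewrite -[RHS](derive_id e v'); apply: near_eq_derive.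
  apply: filterS (filterI (near_dom_at chart_ima) (chart_im_near chart_im1)) => y.
  move=> [[_ _ /= d] cy]; rewrite /s /mul_chart /= !chartK//; last first.
    by move: d; rewrite chartK.
  by rewrite mulg1 mulKg; case: (chart_inv_dom cy).
by move=> E; rewrite -(sX v) E sX.
Qed.

Lemma derive_rtrans v : 'D_v rtrans e = X (v *m adm g) a.
Proof.
apply: (etrans (congr1 (fun w => 'D_w rtrans e) (esym (field1 v)))).
apply: (etrans (field_rtrans _ (mul_chart_dom1l chart_ima))).
exact: (congr1 (X _) rtrans1).
Qed.

Lemma derive_ltrans v : 'D_v ltrans e = X v a.
Proof.
apply: (etrans (congr1 (fun w => 'D_w ltrans e) (esym (field1 v)))).
apply: (etrans (field_ltrans _ (mul_chart_dom1r chart_ima))).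
exact: (congr1 (X _) ltrans1).
Qed.

(* The right translation by [g] maps the left-invariant field of [v] to that of
   [Ad(g^-1) v], whereas the left translation preserves left-invariant fields. *)
Lemma adm_lie_bracket u v :
  lie_bracket c (u *m adm g) (v *m adm g) = lie_bracket c u v *m adm g.
Proof.
have dX z := differentiable_field z chart_im1.
have dXa z : differentiable (X z) (rtrans e).
  by rewrite rtrans1; exact/differentiable_field/chart_ima.
have dXl z : differentiable (X z) (ltrans e).
  by rewrite ltrans1; exact/differentiable_field/chart_ima.
have R1 : 'D_(lie_bracket c u v) rtrans e =
    field_bracket (X (u *m adm g)) (X (v *m adm g)) (rtrans e).
  apply: related_field_bracket => //.
  - by apply: filterS near_dom_r => x; exact: differentiable_rtrans.
  - exact: differentiable_D_rtrans.
  - by apply: filterS near_dom_r => x; exact: field_rtrans.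
  - by apply: filterS near_dom_r => x; exact: field_rtrans.
have L1 u' v' : 'D_(lie_bracket c u' v') ltrans e =
    field_bracket (X u') (X v') (ltrans e).
  apply: related_field_bracket => //.
  - by apply: filterS near_dom_l => x; exact: differentiable_ltrans.
  - exact: differentiable_D_ltrans.
  - by apply: filterS near_dom_l => x; exact: field_ltrans.
  - by apply: filterS near_dom_l => x; exact: field_ltrans.
(* The bracket of the transformed fields at [a] is computed twice: as the left translate of their
   bracket at the identity, and as the right translate of the bracket of [u] and [v]. *)
apply: field_inj; apply: (etrans (esym (derive_ltrans _))).
apply: (etrans (L1 _ _)).
apply: (etrans (congr1 (field_bracket _ _) (etrans ltrans1 (esym rtrans1)))).
apply: (etrans (esym R1)); exact: derive_rtrans.
Qed.

End Translations.

(* Boundedness and differentiation of the adjoint representation *)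
Local Close Scope group_scope.

(* The differentials at the identity of the left and right translations by the
   point with coordinates [b]. *)
Definition lmx b : 'M[R]_n := lin1_mx ('d (fun y => m (b, y)) e).
Definition rmx b : 'M[R]_n := lin1_mx ('d (fun x => m (x, b)) e).

Lemma mul_lmx v b : chart_im c b -> v *m lmx b = X v b.
Proof.
move=> cb; have dm : differentiable (fun y => m (b, y)) e.
  exact/differentiable_slicer/differentiable_mul/mul_chart_dom1r.
exact: (etrans (mul_rV_lin1 _ _) (esym (deriveE v dm))).
Qed.

Lemma mul_rmx v b : chart_im c b -> v *m rmx b = 'D_v (fun x => m (x, b)) e.
Proof.
move=> cb; have dm : differentiable (fun x => m (x, b)) e.
  exact/differentiable_slicel/differentiable_mul/mul_chart_dom1l.
exact: (etrans (mul_rV_lin1 _ _) (esym (deriveE v dm))).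
Qed.

Lemma mul_rmxE v b : chart_im c b -> v *m rmx b = 'D_(v, 0) m (e, b).
Proof.
move=> cb; apply: (etrans (mul_rmx v cb)); apply: derive_pairl.
exact/differentiable_mul/mul_chart_dom1l.
Qed.

(** Since [x * g = g * (g^-1 * x * g)]. This expresses [adm] near 1 by partial derivatives of the
    product in one chart, without differentiating the inverse. *)
Lemma adm_lmx b : chart_im c b -> adm (ci b) *m lmx b = rmx b.
Proof.
move=> cb; have [cg cE] := chart_inv_dom cb.
have cE' : chart_im c (c (ci b)) by rewrite cE.
have E : adm (ci b) *m lmx (c (ci b)) = rmx (c (ci b)).
  apply: mulmx_eqP => v; rewrite mulmxA.
  apply: (etrans (mul_lmx _ cE')); apply: (etrans (esym (derive_rtrans cg v))).
  exact: (esym (mul_rmx v cE')).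
by rewrite cE in E.
Qed.

Lemma lmx1 : lmx e = 1%:M.
Proof.
apply: mulmx_eqP => v; rewrite mulmx1.
exact: (etrans (mul_lmx v chart_im1) (field1 v)).
Qed.

Lemma rmx1 : rmx e = 1%:M.
Proof.
by rewrite -(adm_lmx chart_im1) lmx1 mulmx1 chart_inv1 adm1.
Qed.

Lemma differentiable_mul_lmx v : differentiable (fun b => v *m lmx b) e.
Proof.
apply: near_eq_differentiable (differentiable_field v chart_im1).
by apply: filterS (chart_im_near chart_im1) => b cb; exact: esym (mul_lmx v cb).
Qed.

Lemma differentiable_mul_rmx v : differentiable (fun b => v *m rmx b) e.
Proof.
apply: (@near_eq_differentiable _ _ _ (fun b => 'D_(v, 0) m (e, b))).
  by apply: filterS (chart_im_near chart_im1) => b cb; exact: esym (mul_rmxE v cb).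
apply: (@differentiable_slicer _ _ _ _ ('D_(v, 0) m)).
exact/differentiable_D_mul/mul_chart_dom1l/chart_im1.
Qed.

(** Mixed second derivatives of the product commute at [(e, e)], so differentiating [v *m rmx b]
    along [z] gives the derivative of the field of [z] along [v]. *)
Lemma derive_mul_rmxB z v :
  'D_z (fun b => v *m rmx b - v *m lmx b) e = lie_bracket c v z.
Proof.
have dee := mul_chart_dom1l chart_im1.
have dr : derivable (fun b => v *m rmx b) e z.
  exact/diff_derivable/differentiable_mul_rmx.
have dl : derivable (fun b => v *m lmx b) e z.
  exact/diff_derivable/differentiable_mul_lmx.
apply: (etrans (deriveB dr dl)).
have El : 'D_z (fun b => v *m lmx b) e = 'D_z (X v) e.
  apply: near_eq_derive.
  by apply: filterS (chart_im_near chart_im1) => b cb; exact: mul_lmx.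
have Er : 'D_z (fun b => v *m rmx b) e = 'D_v (X z) e.
  have E1 : \forall b \near e, v *m rmx b = 'D_(v, 0) m (e, b).
    by apply: filterS (chart_im_near chart_im1) => b cb; exact: mul_rmxE.
  have E2 : \forall b \near e, X z b = 'D_(0, z) m (b, e).
    by apply: filterS (chart_im_near chart_im1) => b cb; exact: fieldE.
  apply: (etrans (near_eq_derive z E1)).
  apply: (etrans _ (esym (near_eq_derive v E2))).
  apply: (etrans (derive_pairr z (differentiable_D_mul (v, 0) dee))).
  apply: (etrans _ (esym (derive_pairl v (differentiable_D_mul (0, z) dee)))).
  apply: derive_commute.
  - by apply: filterS (mul_chart_dom_near dee) => w; exact: differentiable_mul.
  - exact: differentiable_D_mul.
  - exact: differentiable_D_mul.
apply: (etrans (congr2 (fun a b : V => a - b) Er El)).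
apply: (congr2 (fun a b : V => a - b)).
  exact: (congr1 (fun w => 'D_w (X z) e) (esym (field1 v))).
exact: (congr1 (fun w => 'D_w (X v) e) (esym (field1 z))).
Qed.

(** Half of [nrm Y] absorbs the error [Y *m (L - 1%:M)]; no inverse of [L] has to be estimated. *)
Lemma nrm_mul_near1 (Y L Z : 'M[R]_n) : Y *m L = Z -> nrm (L - 1%:M) <= 2^-1 ->
  nrm Y <= 2 * nrm Z.
Proof.
move=> YL L1; have YE : Y = Z - Y *m (L - 1%:M).
  by rewrite mulmxBr mulmx1 YL opprB addrC subrK.
have h1 : nrm Y <= nrm Z + nrm (Y *m (L - 1%:M)).
  by rewrite {1}YE -[X in _ <= _ + X]nrmN nrmD.
have h2 : nrm (Y *m (L - 1%:M)) <= nrm Y * 2^-1.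
  by apply: le_trans (nrmM _ _) _; rewrite ler_wpM2l ?nrm_ge0.
by lra.
Qed.

Lemma cvg_entry (L : V -> 'M[R]_n) i j :
  (forall v, differentiable (fun b => v *m L b) e) ->
  (fun b => L b i j) @ e --> L e i j.
Proof.
move=> dL; have E b : L b i j = (delta_mx 0 i *m L b : 'rV[R]_n) 0 j.
  by rewrite -rowE mxE.
rewrite E; under eq_fun do rewrite E.
have cL := differentiable_continuous (dL (delta_mx 0 i)).
exact: (cvg_comp _ _ cL (@coord_continuous _ _ _ 0 j _)).
Qed.

Lemma cvg_nrm_lmx : (fun b => nrm (lmx b - 1%:M)) @ e --> (0 : R).
Proof.
rewrite -(nrm0 R n n) -(subrr (lmx e)).
apply: (@cvg_nrm R _ (nbhs e) (nbhs_filter e)) => i j.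
rewrite mxE [X in _ + X]mxE lmx1; under eq_fun do rewrite mxE [X in _ + X]mxE.
rewrite -{1}lmx1; apply: cvgB; last exact: cvg_cst.
exact: (cvg_entry differentiable_mul_lmx).
Qed.

Lemma near_lmx : \forall b \near e, nrm (lmx b - 1%:M) <= 2^-1.
Proof. by apply: (cvgr_le _ cvg_nrm_lmx); rewrite invr_gt0. Qed.

Lemma near_adm_bounded :
  \forall h \near (1%g : G), nrm (adm h) <= 2 * (nrm (1%:M : 'M[R]_n) + 1).
Proof.
have nr : (fun b => nrm (rmx b)) @ e --> nrm (1%:M : 'M[R]_n).
  rewrite -rmx1; apply: (@cvg_nrm R _ (nbhs e) (nbhs_filter e)) => i j.
  exact: (cvg_entry differentiable_mul_rmx).
have nb : \forall b \near e, nrm (rmx b) <= nrm (1%:M : 'M[R]_n) + 1.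
  by apply: (cvgr_le _ nr); rewrite ltrDl.
have H := filterI nb (filterI near_lmx (chart_im_near chart_im1)).
have H1 : \forall h \near (1%g : G), nrm (rmx (c h)) <= nrm (1%:M : 'M[R]_n) + 1 /\
   nrm (lmx (c h) - 1%:M) <= 2^-1 /\ chart_im c (c h).
  exact: (chart_continuous_at c_id (H _ _)).
apply: filterS (filterI H1 (chart_dom_near c_id)) => h [[b1 [b2 b3]] ch].
have := adm_lmx b3; rewrite chartK// => K.
apply: le_trans (nrm_mul_near1 K b2) _; exact: ler_wpM2l b1.
Qed.

(** Multiplicativity carries the bound near 1 to a neighbourhood of any point, in particular of a
    cluster point of a sequence along which the norms would grow. *)
Lemma adm_bounded : compact [set: G] -> exists M, forall g, nrm (adm g) <= M.
Proof.
move=> Gc; apply: contrapT => /forallNP unb.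
have /(_ _)/cid P k : exists g, k%:R < nrm (adm g).
  by have /existsNP[g /negP] := unb k%:R; rewrite -ltNge; exists g.
pose u k := projT1 (P k).
have uP k : k%:R < nrm (adm (u k)) by exact: (projT2 (P k)).
have [|p [_ clp]] := Gc (fmap u \oo) (fmap_proper_filter u _).
  exact: filterT.
set B := 2 * (nrm (1%:M : 'M[R]_n) + 1).
have nearp : \forall g \near p, nrm (adm g) <= B * nrm (adm p).
  apply: filterS (translate_near p near_adm_bounded) => g gB.
  have -> : adm g = adm (g * p^-1)%g *m adm p.
    by have <- := admM (g * p^-1)%g p; rewrite -mulgA mulVg mulg1.
  by apply: le_trans (nrmM _ _) _; rewrite ler_wpM2r ?nrm_ge0.
pose K := Num.bound (B * nrm (adm p)).
have BK : B * nrm (adm p) < K%:R.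
  by apply/archi_boundP; rewrite mulr_ge0 ?nrm_ge0// mulr_ge0 ?addr_ge0 ?nrm_ge0.
have Ku : (fmap u \oo) [set g | K%:R < nrm (adm g)].
  exists K => // k /= Kk; apply: le_lt_trans (uP k); by rewrite ler_nat.
have [g [/= g1 g2]] := clp _ _ Ku nearp.
by have := lt_le_trans (lt_trans BK g1) g2; rewrite ltxx.
Qed.

(** By [adm_lmx], the difference quotients [W k] of [adm] satisfy [W k *m lmx (a k) = T k]; as
    [lmx (a k)] tends to 1, they have the same limit as [T k], a derivative of [rmx - lmx]. *)
Lemma adm_infinitesimal z : exists chi : nat -> 'M[R]_n,
  [/\ forall k, exists g, chi k = adm g,
      forall k x y, lie_bracket c (x *m chi k) (y *m chi k) =
        lie_bracket c x y *m chi k,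
      exists C, forall k, nrm (2 ^+ k *: (chi k - 1%:M)) <= C &
      mcvg (fun k => 2 ^+ k *: (chi k - 1%:M)) (ad (lie_bracket c) z)].
Proof.
have p2 k : (0 : R) < 2 ^+ k by rewrite exprn_gt0.
pose h k : R := 1 / 2 ^+ k.
have h0 : h @ \oo --> (0 : R) by exact: cvg_geometric2.
have hn0 k : h k != 0 by rewrite mulf_neq0 ?invr_eq0 ?oner_eq0// gt_eqF.
have hV k : (h k)^-1 = 2 ^+ k by rewrite /h mul1r invrK.
(* The sign compensates for the inverse in [adm]: the derivative along [- z] sends [v] to the
   bracket of [v] with [- z], which is that of [z] with [v]. *)
pose a k : V := h k *: (- z) + e.
have ae : a @ \oo --> e.
  have -> : e = 0 *: (- z) + e by rewrite scale0r add0r.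
  by apply: cvgD; [apply: cvgZr_tmp|exact: cvg_cst].
pose T k := 2 ^+ k *: (rmx (a k) - lmx (a k)).
have Tij i j : (fun k => T k i j) @ \oo --> (ad (lie_bracket c) z) i j.
  pose f b := delta_mx 0 i *m rmx b - delta_mx 0 i *m lmx b : V.
  have df : derivable f e (- z).
    apply: derivableB; apply: diff_derivable.
      exact: differentiable_mul_rmx.
    exact: differentiable_mul_lmx.
  have := derive_seq df h0 hn0.
  have -> : 'D_(- z) f e = lie_bracket c z (delta_mx 0 i).
    apply: (etrans (derive_mul_rmxB _ _)).
    by rewrite lie_bracketC (brNl lie_bracketl) opprK.
  move=> fz; have := cvg_comp _ _ fz (@coord_continuous _ _ _ 0 j _).
  have -> : (ad (lie_bracket c) z) i j = lie_bracket c z (delta_mx 0 i) 0 j.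
    by rewrite mxE.
  apply: cvg_trans; apply: near_eq_cvg; apply: nearW => k /=.
  have aux (r l r1 l1 : 'M[R]_n) (s t : R) : s = t -> l1 = 1%:M -> r1 = 1%:M ->
      (s *: (delta_mx 0 i *m r - delta_mx 0 i *m l -
        (delta_mx 0 i *m r1 - delta_mx 0 i *m l1)) : V) 0 j = (t *: (r - l)) i j.
    move=> -> -> ->; rewrite subrr subr0 -mulmxBr scalemxAr -rowE.
    by rewrite mxE.
  exact: aux (hV k) lmx1 rmx1.
pose B := nrm (ad (lie_bracket c) z) + 1.
have nT : \forall k \near \oo, nrm (T k) <= B.
  by apply: (cvgr_le _ (cvg_nrm Tij)); rewrite ltrDl.
pose P k := [/\ nrm (T k) <= B, nrm (lmx (a k) - 1%:M) <= 2^-1 & chart_im c (a k)].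
have nP : \forall k \near \oo, P k.
  have n1 : \forall k \near \oo, nrm (lmx (a k) - 1%:M) <= 2^-1.
    exact: ae _ near_lmx.
  have n2 : \forall k \near \oo, chart_im c (a k).
    exact: ae _ (chart_im_near chart_im1).
  by apply: filterS (filterI nT (filterI n1 n2)) => k [? [? ?]]; split.
pose chi k := if `[< P k >] then adm (ci (a k)) else 1%:M.
pose W k := 2 ^+ k *: (chi k - 1%:M).
have WL k : P k -> W k *m lmx (a k) = T k.
  move=> Pk; rewrite /W /chi (asboolT Pk) -scalemxAl mulmxBl mul1mx.
  by case: Pk => _ _ ca; rewrite (adm_lmx ca).
have B0 : 0 <= B by rewrite addr_ge0 ?nrm_ge0.
have WB k : nrm (W k) <= 2 * B.
  have [Pk|nPk] := pselect (P k).
    have [TB L1 _] := Pk; apply: le_trans (nrm_mul_near1 (WL k Pk) L1) _.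
    by rewrite ler_pM2l.
  by rewrite /W /chi (asboolF nPk) subrr scaler0 nrm0 mulr_ge0.
exists chi; split.
- move=> k; rewrite /chi; case: asboolP => _; first by exists (ci (a k)).
  by exists 1%g; rewrite adm1.
- move=> k x y; rewrite /chi; case: asboolP => [[_ _ ca]|_]; last by rewrite !mulmx1.
  by apply: adm_lie_bracket; case: (chart_inv_dom ca).
- by exists (2 * B).
(* Replaced by [T k] outside [P], so that the comparison with [T] holds for all [k] and not only
   eventually. *)
- pose W' k := if `[< P k >] then W k else T k.
  have TW : mcvg (fun k => W' k - T k) 0.
    have e0 : (fun k => 2 * B * nrm (lmx (a k) - 1%:M)) @ ultra_nat --> (0 : R).
      apply: cvg_ultra; rewrite -[X in _ --> X](mulr0 (2 * B)).
      by apply: cvgM; [exact: cvg_cst|exact: (cvg_comp _ _ ae cvg_nrm_lmx)].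
    apply: (mcvg_nrm_le e0) => k; rewrite subr0 /W'; case: asboolP => [Pk|_].
      rewrite -(WL k Pk) nrmBC.
      rewrite (_ : W k *m lmx (a k) - W k = W k *m (lmx (a k) - 1%:M)).
        by apply: le_trans (nrmM _ _) _; rewrite ler_wpM2r ?nrm_ge0.
      by rewrite mulmxBr mulmx1.
    by rewrite subrr nrm0 !mulr_ge0 ?nrm_ge0.
  have := mcvgD TW (mcvg_eventually Tij); rewrite add0r.
  apply: mcvg_near; apply: filterS nP => k Pk.
  by rewrite /W' (asboolT Pk) subrK.
Qed.

End AdjointRepresentation.

Theorem theorem1p2 (R : realType) (n : nat) (G : lieGroup R n)
  (Gcompact : compact [set: G]%classic)
  (c : chart R n G) (c_atlas : lie_atlas c) (c_id : chart_dom c (1%g : G))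
  (Gsemisimple : is_semisimple (lie_bracket c)) :
  (exists C C' : {vspace 'rV[R]_n},
     [/\ is_cartan (lie_bracket c) C, is_cartan (lie_bracket c) C' &
         killing_orthogonal (lie_bracket c) C C']) /\
  (forall C : {vspace 'rV[R]_n}, is_cartan (lie_bracket c) C ->
     exists C' : {vspace 'rV[R]_n},
       is_cartan (lie_bracket c) C' /\
       killing_orthogonal (lie_bracket c) C C').
Proof.
have [M admB] := adm_bounded c_atlas c_id Gcompact.
(* The bounded matrix group is the image of [adm]; compactness of [G] enters through its bound
   [M]. *)
apply: (@orthogonal_cartan_of_adjoint_group R n (lie_bracket c)
  (lie_bracketl c_atlas c_id) (@lie_bracketC _ _ _ c) Gsemisimple
  [set A | exists g : G, A = adm c g] M).
- by exists 1%g; rewrite adm1.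
- by move=> _ _ [g ->] [h ->]; exists (g * h)%g; rewrite admM.
- move=> _ [g ->]; have [gu gV] := adm_unit c_atlas c_id g.
  by split=> //; exists (g^-1)%g.
- by move=> _ [g ->]; exact: admB.
- by move=> z; exact: adm_infinitesimal.
Qed.
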